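(* Let $(\mathcal{X}_\mathcal{E}, \mathcal{Y}_\mathcal{E}, \alpha, \boldsymbol{\Omega}, \boldsymbol q)$ be a discrete memoryless multimessage multicast network (DM-MMN) with independent channels (possibly with zero-delay edges) on node set $\mathcal{I}=\{1,\ldots,N\}$ and edge set $\mathcal{E}=\mathcal{I}\times\mathcal{I}$, under multicast demand $(\mathcal{V},\mathcal{D})$. Define $$\mathcal{R}_{\text{out}} \triangleq \bigcup_{p_{X_{\mathcal{E}}, Y_{\mathcal{E}}}}\ \bigcap_{T\subseteq \mathcal{I}:\, T^c \cap \mathcal{D} \ne \emptyset } \left\{ R_\mathcal{I}\in \mathbb{R}_+^N \ \Big|\ \sum_{i\in T}R_i \le I_{p_{X_{\mathcal{E}}, Y_{\mathcal{E}}}} (X_{T\times \mathcal{I}};Y_{\mathcal{I}\times T^c}\,|\,X_{T^c\times \mathcal{I}}) \right\},$$ where the union is over all distributions on $\mathcal{X}_\mathcal{E}\times\mathcal{Y}_\mathcal{E}$ of the form $p_{X_{\mathcal{E}}, Y_{\mathcal{E}}} = \prod_{h=1}^\alpha \big(p_{X_{\Omega_h}}\, q^{(h)}_{Y_{\Omega_h} | X_{\Omega_h}}\big)$, with each $p_{X_{\Omega_h}}$ an arbitrary distribution on $\mathcal{X}_{\Omega_h}$. Then for every channel operation sequence $\boldsymbol{\pi}$, $$\mathcal{C}^{\boldsymbol{\pi}}\subseteq\mathcal{R}_{\text{out}},$$ where $\mathcal{C}^{\boldsymbol{\pi}}$ is the $\boldsymbol{\pi}$-capacity region. Hence the capacity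 region satisfies $\mathcal{C}\subseteq\mathcal{R}_{\text{out}}$.
   Context: Notation. $\mathcal{I}=\{1,\ldots,N\}$ (nodes), $\mathcal{E}=\mathcal{I}\times\mathcal{I}$ (directed edges); $T^c=\mathcal{I}\setminus T$; $\mathbb{R}_+$ is the set of non-negative reals; logarithms are to base 2. For $A\subseteq\mathcal{E}$, $X_A=(X_e:e\in A)$, $\mathcal{X}_A=\prod_{e\in A}\mathcal{X}_e$; $X_{A,k}=(X_{e,k}:e\in A)$ for time $k$; a superscript as in $X_A^{k}$ denotes $(X_{A,1},\ldots,X_{A,k})$ (empty if $k=0$); similarly for $Y$. $I_p(\cdot;\cdot|\cdot)$ is conditional mutual information under $p$. Demand. $\mathcal{V}\subseteq\mathcal{I}$ is the set of sources, $\mathcal{D}\subseteq\mathcal{I}$ the set of destinations; each destination wants the messages of all sources. Discrete network. $(\mathcal{X}_\mathcal{E},\mathcal{Y}_\mathcal{E},\alpha,\boldsymbol\Omega,\boldsymbol q)$ consists of finite input alphabets $\mathcal{X}_{(i,j)}$ and finite output alphabets $\mathcal{Y}_{(i,j)}$ for $(i,j)\in\mathcal{E}$, an ordered partition $\boldsymbol\Omega=(\Omega_1,\ldots,\Omega_\alpha)$ of $\mathcal{E}$ into non-empty pairwise disjoint subsets, and channels (conditional distributions) $\boldsymbol q=(q^{(1)},\ldots,q^{(\alpha)})$ with $q^{(h)}=q^{(h)}_{Y_{\Omega_h}|X_{\Omega_h}}$ from $\mathcal{X}_{\Omega_h}$ to $\mathcal{Y}_{\Omega_h}$. Operation sequence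 and delay profile. A channel operation sequence is a permutation $\boldsymbol\pi=(\pi(1),\ldots,\pi(\alpha))$ of $(1,\ldots,\alpha)$; $\Pi$ is the set of all of them. A delay profile is a tuple $B=(b_{(\ell,i,j)}:(\ell,i,j)\in\mathcal{I}^3)$ with entries in $\{0,1\}$ ($b_{(\ell,i,j)}$ is the delay incurred by edge $(\ell,i)$ on edge $(i,j)$). For $(i,j)\in\mathcal{E}$ let $t_{(i,j)}$ be the unique integer with $(i,j)\in\Omega_{\pi(t_{(i,j)})}$. $B$ is feasible with respect to $\boldsymbol\pi$ if for all $(\ell,i,j)$: $b_{(\ell,i,j)}=0$ implies $t_{(\ell,i)}<t_{(i,j)}$. Code. For $\boldsymbol\pi\in\Pi$, $B$ feasible with respect to $\boldsymbol\pi$, and positive integers $n$ and $M_\mathcal{I}=(M_1,\ldots,M_N)$ with $M_i=1$ for $i\notin\mathcal{V}$, a $(\boldsymbol\pi,B,n,M_\mathcal{I})$-code consists of: message sets $\mathcal{W}_i=\{1,\ldots,M_i\}$, with messages $W_i$ uniform on $\mathcal{W}_i$ and independent across $i\in\mathcal{I}$; encoding functions $f_{(i,j),k}:\mathcal{W}_i\times\prod_{\ell\in\mathcal{I}}\mathcal{Y}_{(\ell,i)}^{k-b_{(\ell,i,j)}}\to\mathcal{X}_{(i,j)}$ for $(i,j)\in\mathcal{E}$, $1\le k\le n$, with $X_{(i,j),k}=f_{(i,j),k}(W_i,(Y_{(\ell,i)}^{k-b_{(\ell,i,j)}}:\ell\in\mathcal{I}))$; decoding functions $g_{i,j}:\mathcal{W}_j\times\mathcal{Y}_{\mathcal{I}\times\{j\}}^n\to\mathcal{W}_i$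 for $(i,j)\in\mathcal{V}\times\mathcal{D}$, with $\hat W_{i,j}=g_{i,j}(W_j,Y^n_{\mathcal{I}\times\{j\}})$. DM-MMN. The network is a DM-MMN with independent channels if for every $\boldsymbol\pi$ and every $(\boldsymbol\pi,B,n,M_\mathcal{I})$-code the following holds. With $U^{k-1}=(W_\mathcal{I},X_\mathcal{E}^{k-1},Y_\mathcal{E}^{k-1})$ and $\Omega_{\boldsymbol\pi}^h=\bigcup_{m=1}^h\Omega_{\pi(m)}$ ($\Omega_{\boldsymbol\pi}^0=\emptyset$), for all $k\in\{1,\ldots,n\}$, $h\in\{1,\ldots,\alpha\}$ and all values of the variables, $$\Pr\{U^{k-1}=u^{k-1},X_{\Omega_{\boldsymbol\pi}^h,k}=x_{\Omega_{\boldsymbol\pi}^h,k},Y_{\Omega_{\boldsymbol\pi}^h,k}=y_{\Omega_{\boldsymbol\pi}^h,k}\}$$ $$=\Pr\{U^{k-1}=u^{k-1},X_{\Omega_{\boldsymbol\pi}^h,k}=x_{\Omega_{\boldsymbol\pi}^h,k},Y_{\Omega_{\boldsymbol\pi}^{h-1},k}=y_{\Omega_{\boldsymbol\pi}^{h-1},k}\}\;q^{(\pi(h))}_{Y_{\Omega_{\pi(h)}}|X_{\Omega_{\pi(h)}}}(y_{\Omega_{\pi(h)},k}|x_{\Omega_{\pi(h)},k}).$$ Capacity. The error probability of a code is $P_{\text{err}}^n=\Pr\{\bigcup_{(i,j)\in\mathcal{V}\times\mathcal{D}}\{\hat W_{i,j}\neq W_i\}\}$. A rate tuple $R_\mathcal{I}=(R_1,\ldots,R_N)\in\mathbb{R}_+^N$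 (with $R_i=0$ for $i\notin\mathcal{V}$) is $(\boldsymbol\pi,B)$-achievable if there is a sequence of $(\boldsymbol\pi,B,n,M_\mathcal{I})$-codes ($n=1,2,\ldots$, $M_\mathcal{I}$ depending on $n$) with $\liminf_{n\to\infty}\frac{\log M_i}{n}\ge R_i$ for all $i\in\mathcal{I}$ and $\lim_{n\to\infty}P_{\text{err}}^n=0$. $\mathcal{C}_B^{\boldsymbol\pi}$ is the set of $(\boldsymbol\pi,B)$-achievable rate tuples; $\mathcal{C}^{\boldsymbol\pi}=\bigcup_B\mathcal{C}_B^{\boldsymbol\pi}$ over all $B$ feasible with respect to $\boldsymbol\pi$; $\mathcal{C}=\bigcup_{\boldsymbol\pi\in\Pi}\mathcal{C}^{\boldsymbol\pi}$. *)

(* Defs.v *)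
From HB Require Import structures.
From mathcomp Require Import all_boot all_order all_algebra all_fingroup.
From mathcomp Require Import all_classical all_reals all_analysis.

Set Implicit Arguments.
Unset Strict Implicit.
Unset Printing Implicit Defensive.

Import Order.TTheory GRing.Theory Num.Theory.
Import numFieldNormedType.Exports.

Local Open Scope classical_set_scope.
Local Open Scope ring_scope.

(* All indices are 0-based: nodes are ['I_N], blocks ['I_alpha], and
   [k : 'I_n] stands for time [k + 1]. *)

(** Finite probability and information measures *)

Definition is_pmf (R : realType) (T : finType) (P : T -> R) : Prop :=
  (forall t, 0 <= P t) /\ \sum_(t : T) P t = 1.

Definition pr (R : realType) (T : finType) (P : T -> R) (E : pred T) : R :=
  \sum_(t : T | E t) P t.

Definition log2 (R : realType) (x : R) : R := ln x / ln 2.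

(* I(F; G | H) in bits.  A summand with P{F=f, G=g, H=h} = 0 vanishes; in all
   other summands the four probabilities are positive. *)
Definition cond_mutual_info (R : realType) (T A B C : finType) (P : T -> R)
    (F : T -> A) (G : T -> B) (H : T -> C) : R :=
  \sum_(f : A) \sum_(g : B) \sum_(h : C)
    let pFGH := pr P [pred t | [&& F t == f, G t == g & H t == h]] in
    let pFH := pr P [pred t | (F t == f) && (H t == h)] in
    let pGH := pr P [pred t | (G t == g) && (H t == h)] in
    let pH := pr P [pred t | H t == h] in
    pFGH * log2 (pFGH * pH / (pFH * pGH)).

(** Networks *)

Definition edge (N : nat) : finType := ('I_N * 'I_N)%type.

Definition edge_family (N : nat) (F : edge N -> finType) : finType :=
  {dffun forall e : edge N, F e}.

Definition subfamily (N : nat) (F : edge N -> finType) (A : {set edge N}) :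
    finType :=
  {dffun forall e : {e : edge N | e \in A}, F (val e)}.

Definition restr (N : nat) (F : edge N -> finType) (A : {set edge N})
    (x : edge_family F) : subfamily F A :=
  finfun (fun e : {e : edge N | e \in A} => x (val e)).

Record network (R : realType) (N : nat) := Network {
  inA : edge N -> finType;
  outA : edge N -> finType;
  alpha : nat;
  Omega : 'I_alpha -> {set edge N};
  Omega_nonempty : forall h, Omega h != finset.set0;
  Omega_disjoint : forall h h',
    h != h' -> (Omega h :&: Omega h')%SET = finset.set0;
  Omega_cover : forall e, exists h, e \in Omega h;
  channel : forall h, subfamily inA (Omega h) -> subfamily outA (Omega h) -> R;
  channel_pmf : forall h x, is_pmf (channel (h := h) x)
}.
Arguments channel {R N} net h x y : rename.

Definition op_sequence (R : realType) (N : nat) (net : network R N) :=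
  {perm 'I_(alpha net)}.

(* [B l i j] is the delay incurred by edge (l, i) on edge (i, j); as a number,
   [true] is 1 and [false] is 0. *)
Definition delay_profile (N : nat) := 'I_N -> 'I_N -> 'I_N -> bool.

Lemma edge_time_exists (R : realType) (N : nat) (net : network R N)
    (pi : op_sequence net) (e : edge N) : exists t, e \in Omega (pi t).
Proof.
have [h eh] := Omega_cover net e.
by exists ((pi^-1)%g h); rewrite permKV.
Qed.

Definition edge_time (R : realType) (N : nat) (net : network R N)
    (pi : op_sequence net) (e : edge N) : 'I_(alpha net) :=
  xchoose (edge_time_exists pi e).

Lemma edge_timeP (R : realType) (N : nat) (net : network R N)
    (pi : op_sequence net) (e : edge N) (t : 'I_(alpha net)) :
  (e \in Omega (pi t)) = (t == edge_time pi e).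
Proof.
have et := xchooseP (edge_time_exists pi e).
apply/idP/eqP => [e1|->//]; apply/eqP; apply: contraT => tN.
have /finset.setP/(_ e) :
    (Omega (pi t) :&: Omega (pi (edge_time pi e)))%SET = finset.set0.
  by apply: Omega_disjoint; rewrite (inj_eq perm_inj).
by rewrite finset.inE e1 et finset.inE.
Qed.

Definition feasible (R : realType) (N : nat) (net : network R N)
    (pi : op_sequence net) (B : delay_profile N) : Prop :=
  forall l i j : 'I_N,
    B l i j = false -> (edge_time pi (l, i) < edge_time pi (i, j))%N.

(** Codes *)

(* In [enc i j k], time is k + 1, so the output history of edge (l, i) has
   length k + 1 - b(l, i, j). *)
Record network_code (R : realType) (N : nat) (net : network R N) (V D : {set 'I_N})
    (pi : op_sequence net) (B : delay_profile N) (n : nat) (M : 'I_N -> nat) :=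
  Code {
  code_feasible : feasible pi B;
  code_length_gt0 : (0 < n)%N;
  code_msg_gt0 : forall i, (0 < M i)%N;
  code_msg_source : forall i, i \notin V -> M i = 1%N;
  enc : forall (i j : 'I_N) (k : 'I_n),
    'I_(M i) -> (forall l : 'I_N, (k.+1 - B l i j).-tuple (outA net (l, i))) ->
    inA net (i, j);
  dec : forall (i : {i : 'I_N | i \in V}) (j : {j : 'I_N | j \in D}),
    'I_(M (val j)) -> (forall l : 'I_N, n.-tuple (outA net (l, val j))) ->
    'I_(M (val i))
}.
Arguments enc {R N net V D pi B n M} c i j k w y : rename.
Arguments dec {R N net V D pi B n M} c i j w y : rename.

Definition messages (N : nat) (M : 'I_N -> nat) : finType :=
  {dffun forall i : 'I_N, 'I_(M i)}.

(* The values (w, x^n, y^n) of all random variables of a code, with [x k e] the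
   input of edge [e] at time k + 1. *)
Definition outcome (R : realType) (N : nat) (net : network R N) (n : nat)
    (M : 'I_N -> nat) : finType :=
  (messages M * {ffun 'I_n -> edge_family (inA net)}
     * {ffun 'I_n -> edge_family (outA net)})%type.

Definition outW (R : realType) (N : nat) (net : network R N) (n : nat)
    (M : 'I_N -> nat) (o : outcome net n M) : messages M := o.1.1.
Definition outX (R : realType) (N : nat) (net : network R N) (n : nat)
    (M : 'I_N -> nat) (o : outcome net n M) :
    {ffun 'I_n -> edge_family (inA net)} := o.1.2.
Definition outY (R : realType) (N : nat) (net : network R N) (n : nat)
    (M : 'I_N -> nat) (o : outcome net n M) :
    {ffun 'I_n -> edge_family (outA net)} := o.2.

Definition history (N : nat) (F : edge N -> finType) (n m : nat)
    (le_mn : (m <= n)%N) (y : {ffun 'I_n -> edge_family F}) (e : edge N) :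
    m.-tuple (F e) :=
  [tuple y (widen_ord le_mn t) e | t < m].

Lemma history_leq (n : nat) (k : 'I_n) (b : bool) : (k.+1 - b <= n)%N.
Proof. exact: leq_trans (leq_subr _ _) (ltn_ord k). Qed.

(* The joint law of (W, X^n, Y^n) that the physical network produces under each
   code.  The fields hold for any network: the messages are independent and
   uniform, and the inputs are produced by the encoders.  How the outputs
   behave is left open here. *)
Record operation (R : realType) (N : nat) (net : network R N)
    (V D : {set 'I_N}) := Operation {
  law : forall (pi : op_sequence net) (B : delay_profile N) (n : nat)
    (M : 'I_N -> nat), network_code V D pi B n M -> outcome net n M -> R;
  law_pmf : forall pi B n M (c : network_code V D pi B n M), is_pmf (law c);
  law_messages : forall pi B n M (c : network_code V D pi B n M) (w : messages M),
    pr (law c) [pred o | outW o == w] = \prod_(i < N) (M i)%:R^-1;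
  law_encoding : forall pi B n M (c : network_code V D pi B n M) (o : outcome net n M),
    law c o != 0 ->
    forall (i j : 'I_N) (k : 'I_n),
      outX o k (i, j) =
        enc c i j k (outW o i)
          (fun l => history (history_leq k (B l i j)) (outY o) (l, i))
}.

(** Discrete memoryless networks with independent channels *)

(* The union of the first [h] operated blocks. *)
Definition Omega_prefix (R : realType) (N : nat) (net : network R N)
    (pi : op_sequence net) (h : nat) : {set edge N} :=
  (\bigcup_(m < alpha net | (m < h)%N) Omega (pi m))%SET.

Definition same_on (N : nat) (F : edge N -> finType) (A : {set edge N})
    (x x' : edge_family F) : bool :=
  [forall e in A, x e == x' e].

(* The event U^k = u^k (in 0-based time: everything strictly before [k]),
   X_{A,k} = x_{A,k}, Y_{A',k} = y_{A',k}, where the values are read off from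
   the reference outcome [o]. *)
Definition past_event (R : realType) (N : nat) (net : network R N) (n : nat)
    (M : 'I_N -> nat) (k : 'I_n) (A A' : {set edge N}) (o : outcome net n M) :
    pred (outcome net n M) :=
  [pred o' | [&& outW o' == outW o,
    [forall t : 'I_n, (t < k)%N ==>
       (outX o' t == outX o t) && (outY o' t == outY o t)],
    same_on A (outX o' k) (outX o k) & same_on A' (outY o' k) (outY o k)]].

Definition is_DM_MMN (R : realType) (N : nat) (net : network R N)
    (V D : {set 'I_N}) (op : operation net V D) : Prop :=
  forall (pi : op_sequence net) (B : delay_profile N) (n : nat)
    (M : 'I_N -> nat) (c : network_code V D pi B n M) (k : 'I_n) (h : 'I_(alpha net))
    (o : outcome net n M),
    pr (law op c)
       (past_event k (Omega_prefix pi h.+1) (Omega_prefix pi h.+1) o)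
    = pr (law op c) (past_event k (Omega_prefix pi h.+1) (Omega_prefix pi h) o)
      * channel net (pi h) (restr (Omega (pi h)) (outX o k))
                (restr (Omega (pi h)) (outY o k)).

(** Capacity regions *)

Definition error_prob (R : realType) (N : nat) (net : network R N)
    (V D : {set 'I_N}) (op : operation net V D) (pi : op_sequence net)
    (B : delay_profile N) (n : nat) (M : 'I_N -> nat)
    (c : network_code V D pi B n M) : R :=
  pr (law op c)
    [pred o | [exists i : {i : 'I_N | i \in V}, exists j : {j : 'I_N | j \in D},
       dec c i j (outW o (val j))
         (fun l => history (leqnn n) (outY o) (l, val j)) != outW o (val i)]].

(* The [n]-th code of the sequence has length n + 1.  The limit inferior is
   taken in the extended reals, since it may be infinite. *)
Definition achievable (R : realType) (N : nat) (net : network R N)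
    (V D : {set 'I_N}) (op : operation net V D) (pi : op_sequence net)
    (B : delay_profile N) (r : 'I_N -> R) : Prop :=
  [/\ forall i, 0 <= r i,
      forall i, i \notin V -> r i = 0 &
      exists (M : nat -> 'I_N -> nat) (c : forall n, network_code V D pi B n.+1 (M n)),
        (forall i, ((r i)%:E <=
           limn_einf (fun n => (log2 (M n i)%:R / n.+1%:R)%:E))%E)
        /\ (fun n => error_prob op (c n)) @ \oo --> (0 : R)].

Definition capacity_piB (R : realType) (N : nat) (net : network R N)
    (V D : {set 'I_N}) (op : operation net V D) (pi : op_sequence net)
    (B : delay_profile N) : set ('I_N -> R) :=
  [set r | achievable op pi B r].

Definition capacity_pi (R : realType) (N : nat) (net : network R N)
    (V D : {set 'I_N}) (op : operation net V D) (pi : op_sequence net) :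
    set ('I_N -> R) :=
  \bigcup_(B in [set B | feasible pi B]) capacity_piB op pi B.

Definition capacity (R : realType) (N : nat) (net : network R N)
    (V D : {set 'I_N}) (op : operation net V D) : set ('I_N -> R) :=
  \bigcup_(pi in [set: op_sequence net]) capacity_pi op pi.

(** The outer bound *)

Definition joint (R : realType) (N : nat) (net : network R N) : finType :=
  (edge_family (inA net) * edge_family (outA net))%type.

Definition product_form (R : realType) (N : nat) (net : network R N)
    (p : joint net -> R) : Prop :=
  is_pmf p /\
  exists pX : forall h : 'I_(alpha net), subfamily (inA net) (Omega h) -> R,
    (forall h, is_pmf (pX h)) /\
    forall x y, p (x, y) =
      \prod_(h < alpha net)
        (pX h (restr (Omega h) x)
         * channel net h (restr (Omega h) x) (restr (Omega h) y)).

(* T x I and I x T as sets of edges. *)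
Definition edges_from (N : nat) (T : {set 'I_N}) : {set edge N} :=
  [set e : edge N | e.1 \in T]%SET.
Definition edges_to (N : nat) (T : {set 'I_N}) : {set edge N} :=
  [set e : edge N | e.2 \in T]%SET.

Definition cut_info (R : realType) (N : nat) (net : network R N)
    (p : joint net -> R) (T : {set 'I_N}) : R :=
  cond_mutual_info p
    (fun xy : joint net => restr (edges_from T) xy.1)
    (fun xy : joint net => restr (edges_to (finset.setC T)) xy.2)
    (fun xy : joint net => restr (edges_from (finset.setC T)) xy.1).

(* Nonnegativity is stated outside the intersection, so that it is also there
   when no cut T qualifies. *)
Definition R_out (R : realType) (N : nat) (net : network R N) (D : {set 'I_N}) :
    set ('I_N -> R) :=
  \bigcup_(p in [set p : joint net -> R | product_form p])
    ([set r | forall i, 0 <= r i] `&`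
     \bigcap_(T in [set T : {set 'I_N} |
                      finset.setI (finset.setC T) D != finset.set0])
       [set r | \sum_(i in T) r i <= cut_info p T]).

(* Main.v *)
(** A single Gibbs inequality gives the converse for each code and each cut [T].
    Inputs are functions of the messages [w] and the outputs [y], and the
    memorylessness condition makes the law of [(w, y)] the product of the uniform
    law of [w] and of the channel values, ordered by time and operation order.
    It is compared with a law in which the outputs entering the complement of
    [T] are drawn from the conditional laws, given the inputs leaving that
    complement, that belong to the time-averaged product input distribution,
    and in which the messages of [T] are guessed half the time by the decoder
    and half the time uniformly.  Feasibility of the delays makes this second
    law a product of causal kernels, hence of mass at most one.  The expected
    log-likelihood ratio yields
      (1 - P_err) sum_(i in T) log M_i <= 1 + n I(X_T; Y_(T^c) | X_(T^c))
    for the averaged product law.  Since the ratio is additive over time steps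
    and blocks, no separate concavity or time-sharing argument is needed.
    The averaged laws converge along an ultrafilter on the block lengths, and
    conditional mutual information is continuous. *)

Require Import Defs.
From mathcomp Require Import all_boot all_order all_algebra all_fingroup.
From mathcomp Require Import all_classical all_reals all_analysis.
From mathcomp Require Import ring lra.

Set Implicit Arguments.
Unset Strict Implicit.
Unset Printing Implicit Defensive.

Import Order.TTheory GRing.Theory Num.Theory.
Import numFieldNormedType.Exports.

Local Open Scope classical_set_scope.
Local Open Scope ring_scope.

(** * Sums over products and causal kernels *)

Section FiniteSums.
Variable R : realType.

Lemma sum_dffun_prod (I : finType) (T : I -> finType)
    (F : forall i, T i -> R) :
  \sum_(x : {dffun forall i, T i}) \prod_i F i (x i) =
  \prod_i \sum_(t : T i) F i t.
Proof.
(* [fprod] encodes dependent functions as tagged ones, where distributivity of products over sums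
   for plain functions applies. *)
rewrite (reindex (@dffun_of_fprod I T)); last exact/onW_bij/dffun_of_fprod_bij.
transitivity (\sum_(t : fprod T) \prod_(i in I) [ffun u => F i u] (t i)).
  by apply: eq_bigr => t _; apply: eq_bigr => i _; rewrite !ffunE.
rewrite big_fprod -(bigA_distr_big_dep (tagged_with T)
  (fun i j => untag 0 [ffun u => F i u] j)) /=.
apply: eq_bigr => i _; rewrite -(big_tag (fun i => [ffun u => F i u])).
by apply: eq_bigr => t _; rewrite ffunE.
Qed.

(* [b s z] is the coordinate of [z] revealed at step [s]; [psi s z] is a kernel
   that may depend on the coordinates revealed strictly before [s]. *)
Lemma sum_causal_kernels_le1 (Z K : finType) (U : K -> finType)
    (b : forall s, Z -> U s) (rank : K -> nat) (psi : forall s, Z -> U s -> R)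
    (P : pred Z) :
  injective rank ->
  (forall s z u, 0 <= psi s z u) ->
  (forall s z, \sum_u psi s z u <= 1) ->
  (forall s z z', (forall s', (rank s' < rank s)%N -> b s' z = b s' z') ->
     psi s z =1 psi s z') ->
  {in P &, forall z z', (forall s, b s z = b s z') -> z = z'} ->
  \sum_(z | P z) \prod_s psi s z (b s z) <= 1.
Proof.
move=> rank_inj psi_ge0 psi_le1 psi_dep b_inj.
pose same j z0 z := [forall s, (rank s < j)%N ==> (b s z == b s z0)].
pose tail j z := \prod_(s | (j <= rank s)%N) psi s z (b s z).
have tail_ge0 j z : 0 <= tail j z by apply: prodr_ge0 => s _; exact: psi_ge0.
pose m := (\max_s rank s).+1.
have rank_lt s : (rank s < m)%N by rewrite ltnS; exact: leq_bigmax.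
(* Backward induction on [j], with [d] ranks still to reveal: once the coordinates of rank below [j]
   are fixed, the remaining kernels have mass at most one. *)
have H d j z0 : (j + d = m)%N -> \sum_(z | P z && same j z0 z) tail j z <= 1.
  elim: d j z0 => [|d IH] j z0 jd.
    have -> : j = m by rewrite -jd addn0.
    have tail1 z : tail m z = 1.
      by rewrite /tail big_pred0 // => s; rewrite leqNgt rank_lt.
    (* All coordinates are now fixed, so by [b_inj] at most one [z] remains. *)
    have [z1 /andP[Pz1 sz1]|none] := pickP (fun z => P z && same m z0 z); last first.
      by rewrite big_pred0.
    rewrite (bigD1 z1) ?Pz1 //= tail1 big1 ?addr0 // => z /andP[/andP[Pz sz]].
    case/eqP; apply: b_inj => // s.
    by move/forallP/(_ s): sz; move/forallP/(_ s): sz1;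
      rewrite rank_lt => /eqP -> /eqP ->.
  have sameS z z' : same j.+1 z z' =
      same j z z' && [forall s, (rank s == j) ==> (b s z' == b s z)].
    apply/forallP/andP => [h|[/forallP h1 /forallP h2] s].
      split; apply/forallP => s; apply/implyP => hs; move/implyP: (h s); apply.
        exact: ltnW.
      by rewrite (eqP hs).
    rewrite ltnS leq_eqVlt; apply/implyP => /orP[hs|hs].
      by move/implyP: (h2 s); apply.
    by move/implyP: (h1 s); apply.
  (* [rank] may skip values; if no step has rank [j], nothing is revealed there. *)
  have [s /eqP rs|nors] := pickP (fun s => rank s == j); last first.
    rewrite (eq_bigr (tail j.+1)); last first.
      move=> z _; apply: eq_bigl => s.
      by rewrite leq_eqVlt eq_sym nors.
    rewrite (eq_bigl (fun z => P z && same j.+1 z0 z)).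
      by apply: IH; rewrite addSnnS.
    move=> z; rewrite sameS; congr (_ && _); rewrite [RHS]andbC.
    by case: forallP => // -[] s; rewrite nors.
  (* Sum over the value [u] revealed at [s]: the kernel at [s] depends only on the fixed past, so it
     factors out and the induction hypothesis bounds the rest. *)
  rewrite (partition_big (b s) predT) //=.
  apply: le_trans (psi_le1 s z0); apply: ler_sum => u _.
  have [z1 /andP[/andP[Pz1 sz1] /eqP bz1]|none] :=
    pickP (fun z => P z && same j z0 z && (b s z == u)); last first.
    by rewrite big_pred0.
  rewrite (eq_bigr (fun z => psi s z0 u * tail j.+1 z)); last first.
    move=> z /andP[/andP[Pz /forallP sz] /eqP bz].
    rewrite /tail (bigD1 s) ?rs //= bz; congr (_ * _).
      by apply: psi_dep => s'; rewrite rs => /(implyP (sz s'))/eqP.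
    apply: eq_bigl => s'; rewrite ltn_neqAle -rs andbC; congr (_ && _).
    by rewrite (inj_eq rank_inj) eq_sym.
  rewrite -mulr_sumr -[leRHS]mulr1; apply: ler_wpM2l; first exact: psi_ge0.
  apply: le_trans (IH j.+1 z1 _); last by rewrite addSnnS.
  rewrite le_eqVlt; apply/orP; left; apply/eqP; apply: eq_bigl => z.
  rewrite -andbA; congr (_ && _); rewrite sameS; congr (_ && _).
    apply/forallP/forallP => h s'; apply/implyP => hs';
      move: (implyP (forallP sz1 s') hs') (implyP (h s') hs') => /eqP e1 /eqP e2;
      by rewrite e2 e1.
  apply/eqP/forallP => [bz s'|/(_ s)]; last by rewrite rs eqxx bz1 => /eqP.
  by apply/implyP => /eqP; rewrite -rs => /rank_inj ->; rewrite bz bz1.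
have [z0 Pz0|P0] := pickP P; last by rewrite big_pred0.
apply: le_trans (H m 0%N z0 (add0n _)).
rewrite le_eqVlt; apply/orP; left; apply/eqP; apply: eq_big => z.
  by rewrite /same; case: forallP => [_|[]//]; rewrite andbT.
by move=> _; apply: eq_bigl.
Qed.

End FiniteSums.

(** * Finite information measures *)

Section Information.
Variable R : realType.

Lemma ln2_gt0 : 0 < ln 2 :> R.
Proof. by rewrite ln_gt0 // ltr1n. Qed.

Lemma log2M (x y : R) : 0 < x -> 0 < y -> log2 (x * y) = log2 x + log2 y.
Proof. by move=> x0 y0; rewrite /log2 lnM ?posrE // mulrDl. Qed.

Lemma log2V (x : R) : 0 < x -> log2 x^-1 = - log2 x.
Proof. by move=> x0; rewrite /log2 lnV ?posrE // mulNr. Qed.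

Lemma log2_2 : log2 (2 : R) = 1.
Proof. by rewrite /log2 divff // gt_eqF // ln2_gt0. Qed.

Lemma log2_1 : log2 (1 : R) = 0.
Proof. by rewrite /log2 ln1 mul0r. Qed.

Lemma ler_log2 (x y : R) : 0 < x -> x <= y -> log2 x <= log2 y.
Proof.
move=> x0 xy; rewrite /log2 ler_pM2r ?invr_gt0 ?ln2_gt0 //.
by rewrite ler_ln ?posrE // (lt_le_trans x0).
Qed.

Lemma log2_prod (I : finType) (F : I -> R) : (forall i, 0 < F i) ->
  log2 (\prod_i F i) = \sum_i log2 (F i).
Proof.
move=> F0; have H (r : seq I) : 0 < \prod_(i <- r) F i /\
    log2 (\prod_(i <- r) F i) = \sum_(i <- r) log2 (F i).
  elim: r => [|i r [IH0 IH]]; first by rewrite !big_nil ltr01 log2_1.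
  by rewrite !big_cons mulr_gt0 // log2M // IH.
by case: (H (index_enum I)).
Qed.

(** Follows from [ln x <= x - 1]. Mass at most one on the support of [P] suffices for [Q], so
    sub-probabilities are allowed. *)
Lemma gibbs_inequality (Z : finType) (P Q : Z -> R) : is_pmf P ->
  (forall z, P z != 0 -> 0 < Q z) -> \sum_(z | P z != 0) Q z <= 1 ->
  \sum_z P z * log2 (Q z / P z) <= 0.
Proof.
case=> P_ge0 P1 Q_gt0 Q1.
rewrite (eq_bigr (fun z => P z * ln (Q z / P z) / ln 2)); last first.
  by move=> z _; rewrite /log2 mulrA.
rewrite -mulr_suml pmulr_lle0 ?invr_gt0 ?ln2_gt0 //.
rewrite (bigID (fun z => P z != 0)) /= [X in _ + X]big1 ?addr0; last first.
  by move=> z; rewrite negbK => /eqP ->; rewrite mul0r.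
apply: (@le_trans _ _ (\sum_(z | P z != 0) (Q z - P z))).
  apply: ler_sum => z Pz; have Pz0 : 0 < P z by rewrite lt0r Pz P_ge0.
  have Qz := Q_gt0 _ Pz.
  have /le_ln1Dx : -1 < Q z / P z - 1 by rewrite ltrBrDl subrr divr_gt0.
  rewrite addrC subrK => h; apply: le_trans (ler_wpM2l (ltW Pz0) h) _.
  by rewrite mulrBr mulr1 mulrCA divff ?mulr1 // gt_eqF.
rewrite sumrB subr_le0; apply: le_trans Q1 _.
rewrite -P1 (bigID (fun z => P z != 0)) /= [X in _ + X]big1 ?addr0 //.
by move=> z; rewrite negbK => /eqP.
Qed.

Lemma pr_ge0 (Z : finType) (P : Z -> R) (E : pred Z) :
  (forall z, 0 <= P z) -> 0 <= pr P E.
Proof. by move=> P0; apply: sumr_ge0. Qed.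

Lemma ler_pr (Z : finType) (P : Z -> R) (E E' : pred Z) :
  (forall z, 0 <= P z) -> (forall z, P z != 0 -> E z -> E' z) ->
  pr P E <= pr P E'.
Proof.
move=> P0 EE'; rewrite /pr big_mkcond [leRHS]big_mkcond; apply: ler_sum => z _.
case: ifP => Ez; last by case: ifP.
case: ifP => // E'z; have [->//|Pz] := eqVneq (P z) 0.
by rewrite (EE' _ Pz Ez) in E'z.
Qed.

Lemma eq_pr_supp (Z : finType) (P : Z -> R) (E E' : pred Z) :
  (forall z, P z != 0 -> E z = E' z) -> pr P E = pr P E'.
Proof.
move=> EE'; rewrite /pr big_mkcond [RHS]big_mkcond; apply: eq_bigr => z _.
by have [->|/EE' ->//] := eqVneq (P z) 0; rewrite !if_same.
Qed.

Lemma pr_le (Z : finType) (P : Z -> R) (E : pred Z) (z : Z) :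
  (forall z, 0 <= P z) -> E z -> P z <= pr P E.
Proof. by move=> P0 Ez; rewrite /pr (bigD1 z) //= lerDl sumr_ge0. Qed.

(** The termwise gaps are nonnegative with sum zero. This upgrades one-sided estimates between laws
    of equal mass to equalities. *)
Lemma ler_sum_eq (I : finType) (a b : I -> R) :
  (forall i, a i <= b i) -> \sum_i a i = \sum_i b i -> a =1 b.
Proof.
move=> ab sab i; apply/eqP; rewrite eq_sym -subr_eq0; apply/eqP.
have : \sum_i (b i - a i) = 0 by rewrite sumrB sab subrr.
move/psumr_eq0P => -> // j _; by rewrite subr_ge0.
Qed.

(** Grouping outcomes by the values of [F], [G], [H] exhibits the information as the expectation of
    an information density. *)
Lemma cond_mutual_infoE (Z A B C : finType) (P : Z -> R)
    (F : Z -> A) (G : Z -> B) (H : Z -> C) :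
  cond_mutual_info P F G H =
  \sum_z P z * log2
    (pr P [pred t | [&& F t == F z, G t == G z & H t == H z]]
       * pr P [pred t | H t == H z]
     / (pr P [pred t | (F t == F z) && (H t == H z)]
       * pr P [pred t | (G t == G z) && (H t == H z)])).
Proof.
rewrite [RHS](partition_big F predT) //; apply: eq_bigr => f _.
rewrite [RHS](partition_big G predT) //; apply: eq_bigr => g _.
rewrite [RHS](partition_big H predT) //; apply: eq_bigr => h _ /=.
rewrite {1}/pr mulr_suml; apply: eq_big => z /=; first by rewrite andbA.
by move=> /and3P[/eqP -> /eqP -> /eqP ->].
Qed.

End Information.

(** * Agreement on a set of coordinates *)

Section Agreement.
Variables (I : finType) (T : I -> finType).
Implicit Types (a : pred I) (x y : {dffun forall i, T i}).

Definition agree a x y := [forall i, a i ==> (x i == y i)].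

Definition merge a x y : {dffun forall i, T i} :=
  finfun (fun i => if a i then x i else y i).

Lemma agreeP a x y : reflect (forall i, a i -> x i = y i) (agree a x y).
Proof.
by apply: (iffP forallP) => h i; [move/(implyP (h i))/eqP|apply/implyP=> /h/eqP].
Qed.

Lemma agree_refl a x : agree a x x.
Proof. exact/agreeP. Qed.

Lemma agree_merge a x y z :
  agree a x z && agree (predC a) y z = (z == merge a x y).
Proof.
apply/andP/eqP => [[/agreeP h1 /agreeP h2]|->].
  by apply/ffunP => i; rewrite ffunE; case: ifP => ai; rewrite ?h1 ?h2 //= ai.
by split; apply/agreeP => i /=; rewrite ffunE; [move=> ->|move/negbTE => ->].
Qed.

Lemma agree_eql a x y : agree a x y -> agree a x =1 agree a y.
Proof.
move=> /agreeP xy z; apply/agreeP/agreeP => h i ai; first by rewrite -xy ?h.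
by rewrite xy ?h.
Qed.

Lemma agree_sym a x y : agree a x y = agree a y x.
Proof. by apply/agreeP/agreeP => h i /h. Qed.

(** Fubini for the coordinates in and outside [a]: [x] runs over the values on [a] with the others
    frozen to [y], and each [z] lies only in the fibre of [merge a z y]. *)
Lemma sum_agree_merge (R : realType) a y (f : {dffun forall i, T i} -> R) :
  \sum_(x | agree (predC a) y x) \sum_(z | agree a x z) f z = \sum_z f z.
Proof.
rewrite (exchange_big_dep predT) //=; apply: eq_bigr => z _.
rewrite (big_pred1 (merge a z y)) // => x.
by rewrite /= -agree_merge andbC [agree a z x]agree_sym.
Qed.
End Agreement.

(** * Product laws of a network *)

Section Blocks.
Variables (R : realType) (N : nat) (net : network R N).
Implicit Types (h : 'I_(alpha net)).

Definition block (e : edge N) : 'I_(alpha net) := xchoose (Omega_cover net e).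

Lemma block_in e : e \in Omega (block e).
Proof. exact: (xchooseP (Omega_cover net e)). Qed.

Lemma in_Omega h e : (e \in Omega h) = (h == block e).
Proof.
apply/idP/eqP => [eh|->]; last exact: block_in.
apply/eqP; apply: contraT => /Omega_disjoint/finset.setP/(_ e).
by rewrite finset.inE eh block_in finset.inE.
Qed.

Section Split.
Variable F : edge N -> finType.

Definition split_blocks (x : edge_family F) :
    {dffun forall h, subfamily F (Omega h)} :=
  finfun (fun h => restr (Omega h) x).

Definition glue_blocks (U : {dffun forall h, subfamily F (Omega h)}) :
    edge_family F :=
  finfun (fun e => U (block e) (exist _ e (block_in e))).

Lemma restr_inj_blocks (x x' : edge_family F) :
  (forall h, restr (Omega h) x = restr (Omega h) x') -> x = x'.
Proof.
move=> xx'; apply/ffunP => e.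
by have /ffunP/(_ (exist _ e (block_in e))) := xx' (block e); rewrite !ffunE.
Qed.

Lemma split_blocksK : cancel split_blocks glue_blocks.
Proof. by move=> x; apply/ffunP => e; rewrite !ffunE. Qed.

Lemma glue_blocksK : cancel glue_blocks split_blocks.
Proof.
move=> U; apply/ffunP => h; rewrite ffunE; apply/ffunP => -[e eh].
rewrite !ffunE /=.
have H h' (p : e \in Omega h') (q : e \in Omega h) :
    U h' (exist _ e p) = U h (exist _ e q).
  have E : h' = h by move: p q; rewrite !in_Omega => /eqP -> /eqP ->.
  by subst h'; rewrite (bool_irrelevance p q).
exact: H.
Qed.

Lemma sum_prod_blocks (G : forall h, subfamily F (Omega h) -> R) :
  \sum_(x : edge_family F) \prod_h G h (restr (Omega h) x) =
  \prod_h \sum_u G h u.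
Proof.
rewrite -sum_dffun_prod (reindex split_blocks); last first.
  by apply: onW_bij; exists glue_blocks; [exact: split_blocksK|exact: glue_blocksK].
by apply: eq_bigr => x _; apply: eq_bigr => h _; rewrite ffunE.
Qed.
End Split.

Lemma sum2_prod_blocks
    (G : forall h, subfamily (inA net) (Omega h) ->
       subfamily (outA net) (Omega h) -> R) :
  \sum_(z : joint net) \prod_h G h (restr (Omega h) z.1) (restr (Omega h) z.2) =
  \prod_h \sum_u \sum_v G h u v.
Proof.
rewrite -(pair_bigA _ (fun x y =>
  \prod_h G h (restr (Omega h) x) (restr (Omega h) y))) /=.
rewrite -(sum_prod_blocks (fun h u => \sum_v G h u v)).
by apply: eq_bigr => x _; rewrite (sum_prod_blocks (fun h => G h (restr (Omega h) x))).
Qed.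

Definition on (F : edge N -> finType) (B A : {set edge N}) :
    pred {e : edge N | e \in B} := fun e => val e \in A.
Arguments on F {B} A.

(** Marginals take full block vectors and ignore the coordinates outside [A], which avoids a
    separate type of partial vectors. *)
Definition out_marginal (A : {set edge N}) h (u : subfamily (inA net) (Omega h))
    (v : subfamily (outA net) (Omega h)) : R :=
  \sum_(v' | agree (on (outA net) A) v v') channel net h u v'.

Variable pX : forall h, subfamily (inA net) (Omega h) -> R.
Arguments pX : clear implicits.

Definition in_marginal (A : {set edge N}) h (u : subfamily (inA net) (Omega h)) : R :=
  \sum_(u' | agree (on (inA net) A) u u') pX h u'.

Definition inout_marginal (A A' : {set edge N}) h
    (u : subfamily (inA net) (Omega h)) (v : subfamily (outA net) (Omega h)) : R :=
  \sum_(u' | agree (on (inA net) A) u u') pX h u' * out_marginal A' u' v.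

(* The conditional law of the outputs on [A'] given the inputs on [A]
   (with value [0] when the condition has probability [0]). *)
Definition cond_out (A A' : {set edge N}) h
    (u : subfamily (inA net) (Omega h)) (v : subfamily (outA net) (Omega h)) : R :=
  inout_marginal A A' u v / in_marginal A u.

Lemma channel_ge0 h u v : 0 <= channel net h u v.
Proof. by case: (channel_pmf u). Qed.

Lemma channel_sum h u : \sum_v channel net h u v = 1.
Proof. by case: (channel_pmf u). Qed.

Lemma out_marginal_ge0 A h u v : 0 <= out_marginal A (h := h) u v.
Proof. by apply: sumr_ge0 => *; exact: channel_ge0. Qed.

Lemma channel_le_out_marginal A h u v :
  channel net h u v <= out_marginal A u v.
Proof.
rewrite /out_marginal (bigD1 v) ?agree_refl //= lerDl.
by apply: sumr_ge0 => *; exact: channel_ge0.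
Qed.

Lemma sum_out_marginal (A : {set edge N}) h u v0 :
  \sum_(v | agree (predC (on (outA net) A)) v0 v) out_marginal A (h := h) u v = 1.
Proof. by rewrite /out_marginal sum_agree_merge channel_sum. Qed.

Hypothesis pX_pmf : forall h, is_pmf (pX h).

Lemma pX_ge0 h u : 0 <= pX h u.
Proof. by case: (pX_pmf h). Qed.

Lemma in_marginal_ge0 A h u : 0 <= in_marginal A (h := h) u.
Proof. by apply: sumr_ge0 => *; exact: pX_ge0. Qed.

Lemma le_in_marginal A h u : pX h u <= in_marginal A u.
Proof.
rewrite /in_marginal (bigD1 u) ?agree_refl //= lerDl.
by apply: sumr_ge0 => *; exact: pX_ge0.
Qed.

Lemma inout_marginal_ge0 A A' h u v : 0 <= inout_marginal A A' (h := h) u v.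
Proof. by apply: sumr_ge0 => *; rewrite mulr_ge0 ?pX_ge0 ?out_marginal_ge0. Qed.

Lemma le_inout_marginal A A' h u v :
  pX h u * channel net h u v <= inout_marginal A A' u v.
Proof.
rewrite /inout_marginal (bigD1 u) ?agree_refl //=.
apply: (@le_trans _ _ (pX h u * out_marginal A' u v)).
  by rewrite ler_wpM2l ?pX_ge0 ?channel_le_out_marginal.
by rewrite lerDl; apply: sumr_ge0 => *; rewrite mulr_ge0 ?pX_ge0 ?out_marginal_ge0.
Qed.

Lemma cond_out_ge0 A A' h u v : 0 <= cond_out A A' (h := h) u v.
Proof. by rewrite divr_ge0 ?inout_marginal_ge0 ?in_marginal_ge0. Qed.

Lemma cond_out_gt0 A A' h u v :
  0 < pX h u -> 0 < channel net h u v -> 0 < cond_out A A' u v.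
Proof.
move=> pu qu; rewrite divr_gt0 //.
  by apply: lt_le_trans (le_inout_marginal _ _ _ _); rewrite mulr_gt0.
exact: lt_le_trans pu (le_in_marginal _ _).
Qed.

(** The coordinates in [A'] are free, the others frozen to [v0]. The sum is one unless
    [in_marginal A u] vanishes, and then division by zero makes it zero. *)
Lemma sum_cond_out (A A' : {set edge N}) h u v0 :
  \sum_(v | agree (predC (on (outA net) A')) v0 v) cond_out A A' (h := h) u v <= 1.
Proof.
rewrite /cond_out -mulr_suml /inout_marginal exchange_big /=.
under eq_bigr => u' _ do rewrite -mulr_sumr sum_out_marginal mulr1.
rewrite -/(in_marginal A u).
by have [->|?] := eqVneq (in_marginal A u) 0; rewrite ?mul0r ?ler01 // divff.
Qed.

Lemma cond_out_agree (A A' : {set edge N}) h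
    (u u' : subfamily (inA net) (Omega h)) (v v' : subfamily (outA net) (Omega h)) :
  agree (on (inA net) A) u u' -> agree (on (outA net) A') v v' ->
  cond_out A A' u v = cond_out A A' u' v'.
Proof.
move=> uu' vv'; rewrite /cond_out /inout_marginal /in_marginal.
congr (_ / _); last exact: eq_bigl (agree_eql uu').
rewrite (eq_bigl _ _ (agree_eql uu')); apply: eq_bigr => u1 _.
by congr (_ * _); exact: eq_bigl (agree_eql vv').
Qed.

Definition product_law (z : joint net) : R :=
  \prod_h (pX h (restr (Omega h) z.1)
           * channel net h (restr (Omega h) z.1) (restr (Omega h) z.2)).

Lemma sum_pX_channel h : \sum_u \sum_v pX h u * channel net h u v = 1.
Proof.
under eq_bigr => u _ do rewrite -mulr_sumr channel_sum mulr1.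
by case: (pX_pmf h).
Qed.

Lemma product_law_pmf : is_pmf product_law.
Proof.
split=> [z|]; first by apply: prodr_ge0 => h _; rewrite mulr_ge0 ?pX_ge0 ?channel_ge0.
rewrite (sum2_prod_blocks (fun h u v => pX h u * channel net h u v)).
by rewrite big1 // => h _; exact: sum_pX_channel.
Qed.

Lemma product_law_product_form : product_form product_law.
Proof. by split; [exact: product_law_pmf|exists pX]. Qed.

(** The indicator of an intersection of blockwise events is a product of blockwise indicators, so
    the sum factors. *)
Lemma product_law_rectangle (E : pred (joint net))
    (e : forall h, subfamily (inA net) (Omega h) ->
       subfamily (outA net) (Omega h) -> bool) :
  (forall z, E z = [forall h, e h (restr (Omega h) z.1) (restr (Omega h) z.2)]) ->
  pr product_law E =
  \prod_h \sum_u \sum_v pX h u * channel net h u v * (e h u v)%:R.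
Proof.
move=> Ee; rewrite -(sum2_prod_blocks (fun h u v =>
  pX h u * channel net h u v * (e h u v)%:R)).
rewrite /pr big_mkcond; apply: eq_bigr => z _; rewrite big_split /= -/(product_law z) Ee.
case: forallP => [all|/forallP]; first by rewrite big1 ?mulr1 // => h _; rewrite all.
rewrite negb_forall => /existsP[h /negbTE eh].
by rewrite [X in _ * X](bigD1 h) //= eh mul0r mulr0.
Qed.

Lemma product_law_marginal h0
    (g : subfamily (inA net) (Omega h0) -> subfamily (outA net) (Omega h0) -> R) :
  \sum_z product_law z * g (restr (Omega h0) z.1) (restr (Omega h0) z.2) =
  \sum_u \sum_v pX h0 u * channel net h0 u v * g u v.
Proof.
(* [G] inserts [g] as a factor at block [h0] only, transported along [h = h0]; the other blocks then
   contribute one. *)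
pose G h (u : subfamily (inA net) (Omega h)) (v : subfamily (outA net) (Omega h)) :=
  pX h u * channel net h u v *
  (if h =P h0 is ReflectT e then
     g (eq_rect h (fun h => subfamily (inA net) (Omega h)) u h0 e)
       (eq_rect h (fun h => subfamily (outA net) (Omega h)) v h0 e) else 1).
have G0 u v : G h0 u v = pX h0 u * channel net h0 u v * g u v.
  by rewrite /G; case: eqP => // e; rewrite (eq_axiomK e).
have G1 h u v : h != h0 -> G h u v = pX h u * channel net h u v.
  by rewrite /G; case: eqP => // _ _; rewrite mulr1.
transitivity (\prod_h \sum_u \sum_v G h u v).
  rewrite -sum2_prod_blocks; apply: eq_bigr => z _.
  rewrite /product_law (bigD1 h0) // [RHS](bigD1 h0) //= G0 mulrAC.
  by congr (_ * _); apply: eq_bigr => h /G1 ->.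
rewrite (bigD1 h0) //= [X in _ * X]big1 ?mulr1.
  by apply: eq_bigr => u _; apply: eq_bigr => v _; rewrite G0.
move=> h /G1 hh; under eq_bigr => u _ do under eq_bigr => v _ do rewrite hh.
exact: sum_pX_channel.
Qed.

End Blocks.
Arguments on {N} F {B} A.

(** * Cut information of a product law *)

Section CutInfo.
Variables (R : realType) (N : nat) (net : network R N).

Lemma restr_eqP (F : edge N -> finType) (A : {set edge N}) (x x' : edge_family F) :
  reflect (forall e, e \in A -> x e = x' e) (restr A x == restr A x').
Proof.
apply: (iffP eqP) => [/ffunP h e eA|h].
  by have := h (exist _ e eA); rewrite !ffunE.
by apply/ffunP => -[e eA]; rewrite !ffunE /= h.
Qed.

Lemma restr_eq_blocks (F : edge N -> finType) (A : {set edge N})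
    (x x' : edge_family F) :
  (restr A x' == restr A x) =
  [forall h : 'I_(alpha net),
     agree (on F A) (restr (Omega h) x) (restr (Omega h) x')].
Proof.
apply/restr_eqP/forallP => [xx' h|xx' e eA].
  by apply/agreeP => -[e eh] eA; rewrite !ffunE /= xx'.
have /agreeP/(_ (exist _ e (block_in net e)) eA) := xx' (block net e).
by rewrite !ffunE.
Qed.

Variable pX : forall h : 'I_(alpha net), subfamily (inA net) (Omega h) -> R.
Arguments pX : clear implicits.
Hypothesis pX_pmf : forall h, is_pmf (pX h).

Lemma sum_pX_channel_rect h (a : pred (subfamily (inA net) (Omega h)))
    (b : pred (subfamily (outA net) (Omega h))) :
  \sum_u \sum_v pX h u * channel net h u v * (a u && b v)%:R =
  \sum_(u | a u) pX h u * \sum_(v | b v) channel net h u v.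
Proof.
rewrite [RHS]big_mkcond; apply: eq_bigr => u _; case: ifP => au /=; last first.
  by rewrite big1 // => v _; rewrite mulr0.
rewrite mulr_sumr [RHS]big_mkcond; apply: eq_bigr => v _.
by case: (b v); rewrite ?mulr1 ?mulr0.
Qed.

(** All four events in the information density are blockwise, so their probabilities factor. In each
    block the input probability cancels and leaves the output marginal over [cond_out]; the
    logarithm turns the product into a sum of terms involving one block each. *)
Lemma cut_info_product (T : {set 'I_N}) :
  cut_info (product_law pX) T =
  \sum_h \sum_u \sum_v pX h u * channel net h u v *
    log2 (out_marginal (edges_to (finset.setC T)) u v /
          cond_out pX (edges_from (finset.setC T)) (edges_to (finset.setC T)) u v).
Proof.
set S := edges_to _; set TC := edges_from _.
pose L h u v := log2 (out_marginal S (h := h) u v / cond_out pX TC S u v).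
transitivity (\sum_z product_law pX z *
  \sum_h L h (restr (Omega h) z.1) (restr (Omega h) z.2)); last first.
  under eq_bigr => z _ do rewrite mulr_sumr.
  by rewrite exchange_big; apply: eq_bigr => h _; rewrite product_law_marginal.
rewrite /cut_info cond_mutual_infoE; apply: eq_bigr => -[x y] _ /=.
have [->|pz] := eqVneq (product_law pX (x, y)) 0; first by rewrite !mul0r.
congr (_ * _).
(* Inputs leaving [T] and inputs leaving its complement together fix the whole block input. *)
have agT h u u' : agree (on (inA net) (edges_from T)) u u' &&
    agree (on (inA net) TC) u u' = (u' == u :> subfamily (inA net) (Omega h)).
  apply/andP/eqP => [[/agreeP h1 /agreeP h2]|->]; last by rewrite !agree_refl.
  apply/ffunP => e; case: (boolP ((val e).1 \in T)) => eT.
    by rewrite h1 // /on finset.inE.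
  by rewrite h2 // /on !finset.inE.
have -> : pr (product_law pX)
      [pred t | [&& restr (edges_from T) t.1 == restr (edges_from T) x,
                    restr S t.2 == restr S y & restr TC t.1 == restr TC x]] =
    \prod_h (pX h (restr (Omega h) x) *
             out_marginal S (restr (Omega h) x) (restr (Omega h) y)).
  rewrite (@product_law_rectangle _ _ _ _ _ (fun h u v =>
    (u == restr (Omega h) x) && agree (on (outA net) S) (restr (Omega h) y) v)).
    by apply: eq_bigr => h _; rewrite (sum_pX_channel_rect (pred1 _)) big_pred1_eq.
  move=> [x' y'] /=; rewrite !restr_eq_blocks.
  apply/and3P/forallP => [[/forallP h1 /forallP h2 /forallP h3] h|hh].
    by rewrite -agT h1 h2 h3.
  by split; apply/forallP => h; have := hh h; rewrite -agT => /andP[/andP[]].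
have -> : pr (product_law pX) [pred t | restr TC t.1 == restr TC x] =
    \prod_h in_marginal pX TC (restr (Omega h) x).
  rewrite (@product_law_rectangle _ _ _ _ _ (fun h u v =>
    agree (on (inA net) TC) (restr (Omega h) x) u && predT v)).
    apply: eq_bigr => h _; rewrite sum_pX_channel_rect; apply: eq_bigr => u _.
    by rewrite channel_sum mulr1.
  by move=> [x' y'] /=; rewrite !restr_eq_blocks; apply: eq_forallb => h; rewrite andbT.
have -> : pr (product_law pX)
      [pred t | (restr (edges_from T) t.1 == restr (edges_from T) x) &&
                (restr TC t.1 == restr TC x)] =
    \prod_h pX h (restr (Omega h) x).
  rewrite (@product_law_rectangle _ _ _ _ _ (fun h u v =>
    (u == restr (Omega h) x) && predT v)).
    apply: eq_bigr => h _.
    by rewrite (sum_pX_channel_rect (pred1 _)) big_pred1_eq channel_sum mulr1.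
  move=> [x' y'] /=; rewrite !restr_eq_blocks.
  apply/andP/forallP => [[/forallP h1 /forallP h2] h|hh].
    by rewrite -agT h1 h2.
  by split; apply/forallP => h; have := hh h; rewrite -agT => /andP[/andP[]].
have -> : pr (product_law pX)
      [pred t | (restr S t.2 == restr S y) && (restr TC t.1 == restr TC x)] =
    \prod_h inout_marginal pX TC S (restr (Omega h) x) (restr (Omega h) y).
  rewrite (@product_law_rectangle _ _ _ _ _ (fun h u v =>
    agree (on (inA net) TC) (restr (Omega h) x) u &&
    agree (on (outA net) S) (restr (Omega h) y) v)).
    by apply: eq_bigr => h _; rewrite sum_pX_channel_rect.
  move=> [x' y'] /=; rewrite !restr_eq_blocks.
  apply/andP/forallP => [[/forallP h1 /forallP h2] h|hh].
    by rewrite h1 h2.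
  by split; apply/forallP => h; have /andP[] := hh h.
have pos h : 0 < pX h (restr (Omega h) x) /\
    0 < channel net h (restr (Omega h) x) (restr (Omega h) y).
  have : pX h (restr (Omega h) x) *
      channel net h (restr (Omega h) x) (restr (Omega h) y) != 0.
    by move/prodf_neq0 : pz => /(_ h isT).
  by rewrite mulf_eq0 negb_or !lt0r pX_ge0 ?channel_ge0 // !andbT => /andP.
rewrite -!big_split -prodfV -big_split /= -log2_prod; last first.
  move=> h; have [p0 q0] := pos h; rewrite divr_gt0 ?cond_out_gt0 //.
  exact: lt_le_trans q0 (channel_le_out_marginal _ _ _).
congr log2; apply: eq_bigr => h _; have [p0 q0] := pos h.
have i0 : inout_marginal pX TC S (restr (Omega h) x) (restr (Omega h) y) != 0.
  apply: lt0r_neq0; apply: lt_le_trans (le_inout_marginal pX_pmf _ _ _ _).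
  by rewrite mulr_gt0.
have m0 : in_marginal pX TC (restr (Omega h) x) != 0.
  by apply: lt0r_neq0; apply: lt_le_trans p0 (le_in_marginal pX_pmf _ _).
rewrite /cond_out; field; rewrite i0 m0 /=; exact: lt0r_neq0.
Qed.
End CutInfo.

(** * The law of a code *)

Section CodeLaw.
Variables (R : realType) (N : nat) (net : network R N) (V D : {set 'I_N}).
Variables (op : operation net V D) (pi : op_sequence net) (B : delay_profile N).
Variables (n : nat) (M : 'I_N -> nat) (c : network_code V D pi B n M).
Notation outputs := {ffun 'I_n -> edge_family (outA net)}.
Notation step := ('I_n * 'I_(alpha net))%type.
Implicit Types (w : messages M) (y : outputs) (k : 'I_n) (s : step).

Definition inputs w y : {ffun 'I_n -> edge_family (inA net)} :=
  [ffun k => finfun (fun e : edge N =>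
     let: (i, j) := e return inA net e in
     enc c i j k (w i) (fun l => history (history_leq k (B l i j)) y (l, i)))].

(** Channel uses are ordered lexicographically, by time and then by operation order. As
    [(pi^-1)%g h] is the position of block [h], an edge has the rank of its block. *)
Definition edge_rank k (e : edge N) : nat := k * alpha net + edge_time pi e.
Definition step_rank s : nat := s.1 * alpha net + (pi^-1)%g s.2.

Lemma step_rank_inj : injective step_rank.
Proof.
move=> [k h] [k' h']; rewrite /step_rank /= => /eqP.
have lt (h0 : 'I_(alpha net)) : ((pi^-1)%g h0 < alpha net)%N by [].
have a0 : (0 < alpha net)%N by apply: leq_ltn_trans (lt h).
move=> /eqP E; have /(congr1 (divn^~ (alpha net))) := E.
rewrite !divnMDl // !divn_small ?addn0 // => kk.
have /(congr1 (modn^~ (alpha net))) := E.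
rewrite !modnMDl !modn_small // => /val_inj/perm_inj ->.
by congr (_, _); apply: val_inj.
Qed.

Lemma step_rank_lt s : (step_rank s < n * alpha net)%N.
Proof.
case: s => k h; rewrite /step_rank /=.
apply: (@leq_trans (k.+1 * alpha net)); first by rewrite mulSn addnC ltn_add2r.
by rewrite leq_mul2r ltn_ord orbT.
Qed.

Lemma step_rank_surj j : (j < n * alpha net)%N -> exists s, step_rank s = j.
Proof.
move=> jn; have a0 : (0 < alpha net)%N by case: (alpha net) jn; rewrite ?muln0.
have k_lt : (j %/ alpha net < n)%N by rewrite ltn_divLR.
exists (Ordinal k_lt, pi (Ordinal (ltn_pmod j a0))).
by rewrite /step_rank /= permK /= -divn_eq.
Qed.

Lemma edge_rank_block k e : edge_rank k e = step_rank (k, block net e).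
Proof.
rewrite /edge_rank /step_rank /=; congr (_ + nat_of_ord _)%N; apply/eqP.
by rewrite eq_sym -edge_timeP permKV block_in.
Qed.

Lemma edge_rank_Omega s e : e \in Omega s.2 -> edge_rank s.1 e = step_rank s.
Proof. by rewrite in_Omega edge_rank_block => /eqP <-; case: s. Qed.

Lemma mem_Omega_prefix m e : (e \in Omega_prefix pi m) = (edge_time pi e < m)%N.
Proof.
apply/bigcupP/idP => [[t tm]|em]; first by rewrite edge_timeP => /eqP <-.
by exists (edge_time pi e) => //; rewrite edge_timeP.
Qed.

(* By feasibility, an encoder only uses outputs of strictly smaller rank. *)
Lemma inputs_causal w w' y y' k i j :
  w i = w' i ->
  (forall l k', (edge_rank k' (l, i) < edge_rank k (i, j))%N ->
     y k' (l, i) = y' k' (l, i)) ->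
  inputs w y k (i, j) = inputs w' y' k (i, j).
Proof.
move=> ww yy; rewrite !ffunE ww; congr (enc c i j k _ _).
apply: functional_extensionality_dep => l; apply: eq_from_tnth => t.
rewrite !tnth_mktuple; apply: yy; rewrite /edge_rank /=.
have tk : (t < k.+1 - B l i j)%N by [].
move: (nat_of_ord t) tk => {}t tk.
(* With zero delay the history may include time [k] itself, but feasibility places [(l, i)] earlier
   in the operation order. With unit delay it stops before time [k]. *)
have [Bf|Bt] := boolP (B l i j); last first.
  have tl := code_feasible c (negbTE Bt).
  rewrite (negbTE Bt) subn0 ltnS in tk.
  apply: (@leq_ltn_trans (k * alpha net + edge_time pi (l, i))).
    by rewrite leq_add2r leq_mul2r tk orbT.
  by rewrite ltn_add2l.
rewrite Bf subn1 /= in tk.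
apply: (@leq_trans (t.+1 * alpha net)); first by rewrite mulSn addnC ltn_add2r.
by apply: leq_trans (leq_addr _ _); rewrite leq_mul2r tk orbT.
Qed.

Lemma inputs_past w y y' s :
  (forall k e, (edge_rank k e < step_rank s)%N -> y k e = y' k e) ->
  restr (Omega s.2) (inputs w y s.1) = restr (Omega s.2) (inputs w y' s.1).
Proof.
move=> yy; apply/ffunP => -[[i j] es]; rewrite ffunE [RHS]ffunE /=.
apply: inputs_causal => // l k'.
by rewrite (edge_rank_Omega es); exact: yy.
Qed.

(** * Support and factorization of the law of a code *)

Notation P := (law op c).
Definition code_law w y : R := P (w, inputs w y, y).

Lemma law_ge0 o : 0 <= P o.
Proof. by case: (law_pmf op c). Qed.

Lemma law_inputs (o : outcome net n M) : P o != 0 ->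
  outX o = inputs (outW o) (outY o).
Proof.
move=> /law_encoding Po; apply/ffunP => k; apply/ffunP => -[i j].
by rewrite Po !ffunE.
Qed.

Lemma law_supp (o : outcome net n M) : P o != 0 ->
  o = (outW o, inputs (outW o) (outY o), outY o).
Proof. by move=> /law_inputs <-; case: o => [[]]. Qed.

(** The law charges only outcomes whose inputs are those computed by the encoders. *)
Lemma sum_law (f : outcome net n M -> R) :
  \sum_o P o * f o = \sum_w \sum_y code_law w y * f (w, inputs w y, y).
Proof.
rewrite pair_bigA /= (partition_big (fun o => (outW o, outY o)) predT) //=.
apply: eq_bigr => -[w y] _ /=; rewrite (bigD1 (w, inputs w y, y)) /= ?eqxx //.
rewrite big1 ?addr0 // => o /andP[/eqP[<- <-]].
by have [->|/law_supp <-] := eqVneq (P o) 0; rewrite ?mul0r ?eqxx.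
Qed.

(** Inputs are left out: on the support of the law, messages and outputs determine them. *)
Definition cylinder j w y : pred (outcome net n M) :=
  [pred o | (outW o == w) &&
     [forall k, forall e, (edge_rank k e < j)%N ==> (outY o k e == y k e)]].

Lemma cylinderP j w y o :
  reflect (outW o = w /\ forall k e, (edge_rank k e < j)%N -> outY o k e = y k e)
    (cylinder j w y o).
Proof.
apply: (iffP andP) => -[/eqP ww h]; split=> //.
  by move=> k e ke; apply/eqP; move/forallP: h => /(_ k)/forallP/(_ e)/implyP; apply.
by apply/forallP => k; apply/forallP => e; apply/implyP => /h/eqP.
Qed.

Hypothesis Hnet : is_DM_MMN op.

Lemma edge_rank_lt k e t m : (m <= alpha net)%N ->
  (edge_rank k e < t * alpha net + m)%N =
  (k < t)%N || (k == t :> nat) && (edge_time pi e < m)%N.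
Proof.
move=> m_le; rewrite /edge_rank; have lt := ltn_ord (edge_time pi e).
case: (ltngtP k t) => [kt|tk|->] /=; last by rewrite ltn_add2l.
- apply: (@leq_trans (k.+1 * alpha net)); first by rewrite mulSn addnC ltn_add2r.
  by apply: leq_trans (leq_addr _ _); rewrite leq_mul2r kt orbT.
- apply/negbTE; rewrite -leqNgt; apply: leq_trans (leq_addr _ _).
  apply: (@leq_trans (t.+1 * alpha net)); first by rewrite mulSn addnC leq_add2r.
  by rewrite leq_mul2r tk orbT.
Qed.

(** On the support, inputs up to and including the next block depend only on the messages and on
    outputs fixed by the cylinder, so the input conditions hold automatically. Hence the input
    prefix may be one block longer than the output prefix. *)
Lemma past_event_cylinder w y k (m m' : nat) o : (m' <= m <= m'.+1)%N ->
  (m <= alpha net)%N -> P o != 0 ->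
  past_event k (Omega_prefix pi m) (Omega_prefix pi m') (w, inputs w y, y) o =
  cylinder (k * alpha net + m') w y o.
Proof.
move=> /andP[m'm mm'] m_le Po; have m'_le := leq_trans m'm m_le.
apply/and4P/cylinderP => [[/eqP ww /forallP past _ sameY]|[ww yy]].
  split=> // k' e; rewrite edge_rank_lt // => /orP[k'k|/andP[/eqP/val_inj -> et]].
    by move/implyP: (past k') => /(_ k'k)/andP[_ /eqP] ->.
  by move/forallP: sameY => /(_ e); rewrite mem_Omega_prefix et => /eqP.
have xx k' e : (edge_rank k' e <= k * alpha net + m')%N ->
    outX o k' e = inputs w y k' e.
  move=> k'e; rewrite law_inputs // ww; case: e k'e => i j k'e.
  apply: inputs_causal => // l k'' lt; apply: yy; exact: leq_trans lt k'e.
split; first by rewrite ww.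
- apply/forallP => t; apply/implyP => tk; apply/andP; split; apply/eqP/ffunP => e.
    by apply: xx; apply: ltnW; rewrite edge_rank_lt // tk.
  by apply: yy; rewrite edge_rank_lt // tk.
- apply/forallP => e; apply/implyP; rewrite mem_Omega_prefix => et.
  apply/eqP/xx; rewrite /edge_rank leq_add2l -ltnS; exact: leq_trans et mm'.
- apply/forallP => e; apply/implyP; rewrite mem_Omega_prefix => et.
  by apply/eqP/yy; rewrite edge_rank_lt // eqxx et orbT.
Qed.

(** The memorylessness condition at time [s.1] and at the position of block [s.2], with both past
    events read as cylinders. *)
Lemma pr_cylinderS s w y :
  pr P (cylinder (step_rank s).+1 w y) =
  pr P (cylinder (step_rank s) w y) *
  channel net s.2 (restr (Omega s.2) (inputs w y s.1)) (restr (Omega s.2) (y s.1)).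
Proof.
have := Hnet c s.1 ((pi^-1)%g s.2) (w, inputs w y, y).
rewrite permKV /= => E; rewrite -addnS.
set t := (pi^-1)%g s.2 in E *.
rewrite -(@eq_pr_supp _ _ P _ _
  (fun o => @past_event_cylinder w y s.1 t.+1 t.+1 o _ _)) ?leqnn ?leqnSn // {}E.
congr (_ * _); apply: eq_pr_supp => o Po.
by rewrite past_event_cylinder // leqnn leqnSn.
Qed.

Lemma pr_cylinder j w y : (j <= n * alpha net)%N ->
  pr P (cylinder j w y) = (\prod_(i < N) (M i)%:R^-1) *
    \prod_(s | (step_rank s < j)%N)
      channel net s.2 (restr (Omega s.2) (inputs w y s.1)) (restr (Omega s.2) (y s.1)).
Proof.
elim: j => [|j IH] j_le.
  rewrite big_pred0 // mulr1 -(law_messages op c w); apply: eq_pr_supp => o _.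
  by apply/cylinderP/eqP => [[]|->].
have [s sj] := step_rank_surj j_le.
move: IH j_le; rewrite -{j}sj => IH j_le.
rewrite pr_cylinderS (IH (ltnW j_le)) -mulrA; congr (_ * _).
rewrite [RHS](bigD1 s) ?ltnSn //= mulrC; congr (_ * _).
apply: eq_bigl => s'; rewrite ltnS [in RHS]leq_eqVlt (inj_eq (@step_rank_inj)).
by case: eqP => [->|]; rewrite ?ltnn ?andbF ?andbT.
Qed.

(** A cylinder of full rank fixes all outputs, so it meets the support in at most one outcome. *)
Lemma code_lawE w y : code_law w y = (\prod_(i < N) (M i)%:R^-1) *
  \prod_s channel net s.2 (restr (Omega s.2) (inputs w y s.1))
    (restr (Omega s.2) (y s.1)).
Proof.
transitivity (pr P (cylinder (n * alpha net) w y)); last first.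
  by rewrite pr_cylinder //; congr (_ * _); apply: eq_bigl => s; rewrite step_rank_lt.
rewrite (@eq_pr_supp _ _ _ _ (pred1 (w, inputs w y, y))).
  by rewrite /pr big_pred1_eq.
move=> o Po; apply/cylinderP/eqP => [[ww yy]|->//].
have yE : outY o = y.
  apply/ffunP => k; apply/ffunP => e; apply: yy.
  by rewrite edge_rank_block step_rank_lt.
by rewrite (law_supp Po) ww yE.
Qed.

Lemma outcome_exists : exists o : outcome net n M, P o != 0.
Proof.
have [_ P1] := law_pmf op c; apply: contrapT => none.
move: P1; rewrite big1 => [/eqP|o _]; first by rewrite eq_sym oner_eq0.
by apply/eqP; apply: contrapT => /negP Po; apply: none; exists o.
Qed.

(** The conditioning is on the block input alone, not on the whole past. Splitting by the past gives
    one inequality; both sides have total mass one over [u] and [v], so equality holds. *)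
Lemma pr_block s (u : subfamily (inA net) (Omega s.2)) v :
  pr P [pred o | (restr (Omega s.2) (outX o s.1) == u) &&
                 (restr (Omega s.2) (outY o s.1) == v)] =
  pr P [pred o | restr (Omega s.2) (outX o s.1) == u] * channel net s.2 u v.
Proof.
pose in_blk (o : outcome net n M) := restr (Omega s.2) (outX o s.1).
pose out_blk (o : outcome net n M) := restr (Omega s.2) (outY o s.1).
pose blocks := (subfamily (inA net) (Omega s.2) * subfamily (outA net) (Omega s.2))%type.
pose a (uv : blocks) := pr P [pred o | (in_blk o == uv.1) && (out_blk o == uv.2)].
pose b (uv : blocks) := pr P [pred o | in_blk o == uv.1] * channel net s.2 uv.1 uv.2.
suff /(_ (u, v)) : a =1 b by [].
have [_ P1] := law_pmf op c.
apply: ler_sum_eq; last first.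
  rewrite -(pair_bigA _ (fun u v => b (u, v))) /b /=.
  under [RHS]eq_bigr => u' _ do rewrite -mulr_sumr channel_sum mulr1.
  transitivity (1 : R).
    by rewrite -P1 (partition_big (fun o => (in_blk o, out_blk o)) predT).
  by rewrite -P1 (partition_big in_blk predT).
move=> [{}u {}v]; rewrite /a /b /=.
have [ref _] := outcome_exists.
(* Overwriting the outputs from step [s] on by those of a fixed outcome makes [key] record exactly
   the messages and the earlier outputs. *)
pose trunc (y : outputs) : outputs :=
  [ffun k => merge (fun e => (edge_rank k e < step_rank s)%N) (y k) (outY ref k)].
pose key (o : outcome net n M) := (outW o, trunc (outY o)).
have keyP o w y : (key o == (w, trunc y)) = cylinder (step_rank s) w y o.
  apply/eqP/cylinderP => [[ww /ffunP cc]|[ww yy]].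
    split=> // k e ke; have /ffunP/(_ e) := cc k; by rewrite !ffunE ke.
  rewrite /key ww; congr (_, _); apply/ffunP => k; apply/ffunP => e.
  by rewrite !ffunE; case: ifP => // /yy.
rewrite /pr (partition_big key predT) //= [X in _ <= X * _](partition_big key predT) //=.
rewrite mulr_suml; apply: ler_sum => w _.
have [oo /andP[/andP[/andP[/eqP xo /eqP yo] /eqP ko] Po]|none] :=
  pickP (fun o => (in_blk o == u) && (out_blk o == v) && (key o == w) && (P o != 0));
    last first.
  rewrite big1 ?mulr_ge0 ?channel_ge0 ?sumr_ge0 // => [? _|o hh]; first exact: law_ge0.
  by apply/eqP; have := none o; rewrite /= hh /= => /negbT; rewrite negbK.
have := pr_cylinderS s (outW oo) (outY oo).
rewrite -law_inputs // -/(in_blk oo) -/(out_blk oo) xo yo => E.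
(* Within one past, the event on the left lies in the cylinder one step longer, and the event on the
   right contains the current cylinder, since the past determines the block input. *)
apply: (@le_trans _ _ (pr P (cylinder (step_rank s).+1 (outW oo) (outY oo)))).
  apply: (@ler_pr _ _ P _ (cylinder (step_rank s).+1 (outW oo) (outY oo)))
    => [|o' Po' /=]; first exact: law_ge0.
  move=> /andP[/andP[_ /eqP yo']]; rewrite -ko keyP => /cylinderP[ww yy].
  apply/cylinderP; split=> // k e; rewrite ltnS leq_eqVlt => /orP[/eqP ke|/yy//].
  move: ke; rewrite edge_rank_block => /step_rank_inj ke.
  have es : e \in Omega s.2 by rewrite in_Omega -ke.
  have := yo'; rewrite -yo /out_blk => /ffunP/(_ (exist _ e es)); rewrite !ffunE /=.
  by rewrite -[in s.1]ke.
rewrite E ler_wpM2r ?channel_ge0 //.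
apply: (@ler_pr _ _ P _ _) => [|o' Po' cyl /=]; first exact: law_ge0.
rewrite -ko keyP cyl andbT -xo; move/cylinderP: cyl => [ww yy].
by rewrite /in_blk !law_inputs // ww; apply/eqP; exact: inputs_past.
Qed.
End CodeLaw.

(** * The converse for one code and one cut *)

Section Converse.
Variables (R : realType) (N : nat) (net : network R N) (V D : {set 'I_N}).
Variables (op : operation net V D) (pi : op_sequence net) (B : delay_profile N).
Variables (n : nat) (M : 'I_N -> nat) (c : network_code V D pi B n M).
Hypothesis Hnet : is_DM_MMN op.
Notation outputs := {ffun 'I_n -> edge_family (outA net)}.
Notation step := ('I_n * 'I_(alpha net))%type.
Notation P := (law op c).

(** The average over time is taken block by block; in [product_law mean_input] the blocks become
    independent. *)
Definition mean_input (h : 'I_(alpha net)) (u : subfamily (inA net) (Omega h)) : R :=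
  n%:R^-1 * \sum_(k < n) pr P [pred o | restr (Omega h) (outX o k) == u].

Lemma code_length_neq0 : n%:R != 0 :> R.
Proof. by rewrite pnatr_eq0 -lt0n (code_length_gt0 c). Qed.

Lemma mean_input_pmf h : is_pmf (@mean_input h).
Proof.
split=> [u|].
  by rewrite mulr_ge0 ?invr_ge0 // sumr_ge0 // => k _; exact/pr_ge0/law_ge0.
rewrite -mulr_sumr exchange_big /= (eq_bigr (fun _ => 1)) => [|k _].
  by rewrite sumr_const card_ord mulVf // code_length_neq0.
have [_ <-] := law_pmf op c.
by rewrite [RHS](partition_big (fun o => restr (Omega h) (outX o k)) predT).
Qed.

(** Ensures that the comparison law is positive wherever the law of the code is. *)
Lemma mean_input_gt0 (o : outcome net n M) (s : step) :
  P o != 0 -> 0 < mean_input (restr (Omega s.2) (outX o s.1)).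
Proof.
move=> Po; have n0 := code_length_gt0 c.
rewrite mulr_gt0 ?invr_gt0 ?ltr0n // (bigD1 s.1) //= ltr_pwDl //.
  apply: (@lt_le_trans _ _ (P o)); first by rewrite lt0r Po law_ge0.
  by apply: pr_le; [exact: law_ge0|rewrite /= eqxx].
by apply: sumr_ge0 => k _; apply/pr_ge0/law_ge0.
Qed.

(** * Kernels across a fixed cut *)

Variables (T : {set 'I_N}) (d : {j : 'I_N | j \in D}).
Hypothesis dT : val d \notin T.
Notation S := (edges_to (finset.setC T)).
Notation TC := (edges_from (finset.setC T)).
Implicit Types (w : messages M) (y : outputs) (s : step).

Definition in_block w y s := restr (Omega s.2) (inputs c w y s.1).
Definition out_block y s := restr (Omega s.2) (y s.1).

Definition agree_out (A : {set edge N}) y y' :=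
  [forall k, agree (fun e => e \in A) (y k) (y' k)].

Lemma agree_outP (A : {set edge N}) y y' :
  reflect (forall k e, e \in A -> y k e = y' k e) (agree_out A y y').
Proof.
by apply: (iffP forallP) => [h k|h k]; [exact/agreeP|apply/agreeP => e; exact: h].
Qed.

Lemma agree_out_block s (A : {set edge N}) y y' : agree_out A y y' ->
  agree (on (outA net) A) (out_block y s) (out_block y' s).
Proof.
by move=> /agree_outP yy; apply/agreeP => -[e es] eA; rewrite !ffunE /= yy.
Qed.

Lemma sum_agree_out (A : {set edge N}) (y0 : outputs) (f : outputs -> R) :
  \sum_(y | agree_out (finset.setC A) y0 y) \sum_(z | agree_out A y z) f z =
  \sum_z f z.
Proof.
rewrite (exchange_big_dep predT) //=; apply: eq_bigr => z _.
pose m : outputs := [ffun k => merge (fun e => e \in A) (z k) (y0 k)].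
rewrite (big_pred1 m) // => y; apply/andP/eqP => [[/agree_outP h1 /agree_outP h2]|->].
  apply/ffunP => k; apply/ffunP => e; rewrite !ffunE /=.
  by case: ifP => eA; [exact: h2|rewrite h1 // finset.inE eA].
split; apply/agree_outP => k e; rewrite ?finset.inE !ffunE /=; last by move=> ->.
by move/negbTE => ->.
Qed.

(** [cut_kernel] generates the outputs entering the complement of [T] from the inputs leaving it;
    [rest_kernel] generates the others by the true channel, given the block input and those
    outputs. *)
Definition cut_kernel w y s : R :=
  cond_out mean_input TC S (in_block w y s) (out_block y s).
Definition rest_kernel w y s : R :=
  channel net s.2 (in_block w y s) (out_block y s) /
  out_marginal S (in_block w y s) (out_block y s).

Lemma cut_kernel_ge0 w y s : 0 <= cut_kernel w y s.
Proof. exact/cond_out_ge0/mean_input_pmf. Qed.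

Lemma prod_cut_kernel_ge0 w y : 0 <= \prod_s cut_kernel w y s.
Proof. by apply: prodr_ge0 => s _; exact: cut_kernel_ge0. Qed.

(** A node outside [T] encodes from its own message and the outputs entering it, which lie in
    [S]. *)
Lemma cut_kernel_agree w w' y y' s : agree (fun i => i \notin T) w w' ->
  agree_out S y y' -> cut_kernel w y s = cut_kernel w' y' s.
Proof.
move=> /agreeP ww yy; apply: cond_out_agree; last exact: agree_out_block.
apply/agreeP => -[[i j] es]; rewrite /on !finset.inE /= => iT.
rewrite ffunE [RHS]ffunE /=; apply: inputs_causal => [|l k' _]; first exact: ww.
by move/agree_outP: yy; apply; rewrite !finset.inE.
Qed.

Lemma out_block_past y y' s :
  (forall s', (step_rank pi s' < step_rank pi s)%N -> out_block y s' = out_block y' s') ->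
  forall k e, (edge_rank pi k e < step_rank pi s)%N -> y k e = y' k e.
Proof.
move=> yy k e ke; rewrite edge_rank_block in ke.
by have /ffunP/(_ (exist _ e (block_in net e))) := yy _ ke; rewrite !ffunE.
Qed.

Lemma out_block_inj y y' : (forall s, out_block y s = out_block y' s) -> y = y'.
Proof.
move=> yy; apply/ffunP => k; apply: restr_inj_blocks => h.
exact: yy (k, h).
Qed.

Lemma sum_rest_kernel_le1 w y0 :
  \sum_(y | agree_out S y0 y) \prod_s rest_kernel w y s <= 1.
Proof.
(* An indicator in each kernel expresses that the outputs in [S] are fixed to those of [y0], so
   every kernel has mass at most one. *)
pose psi s y v := channel net s.2 (in_block w y s) v / out_marginal S (in_block w y s) v *
  (agree (on (outA net) S) (out_block y0 s) v)%:R.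
rewrite (eq_bigr (fun y => \prod_s psi s y (out_block y s))); last first.
  by move=> y yy; apply: eq_bigr => s _; rewrite /psi agree_out_block ?mulr1.
apply: (sum_causal_kernels_le1 (psi := psi) (rank := @step_rank _ _ _ pi n))
  => [|s y v|s y|s y y' yy|y y' _ _].
- exact: step_rank_inj.
- by rewrite /psi mulr_ge0 ?divr_ge0 ?channel_ge0 ?out_marginal_ge0.
- rewrite /psi (eq_bigr (fun v => if agree (on (outA net) S) (out_block y0 s) v
    then channel net s.2 (in_block w y s) v /
      out_marginal S (in_block w y s) (out_block y0 s)
    else 0)).
    rewrite -big_mkcond /= -mulr_suml.
    rewrite -/(out_marginal S (in_block w y s) (out_block y0 s)).
    by have [->|?] := eqVneq (out_marginal S (in_block w y s) (out_block y0 s)) 0;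
      rewrite ?mul0r ?ler01 // divff.
  move=> v _; case: ifP => yv; last by rewrite mulr0.
  by rewrite mulr1 /out_marginal (eq_bigl _ _ (agree_eql yv)).
- by move=> v; rewrite /psi /in_block (inputs_past c w (out_block_past yy)).
- exact: out_block_inj.
Qed.

Lemma sum_cut_kernel_le1 w y0 :
  \sum_(y | agree_out (finset.setC S) y0 y) \prod_s cut_kernel w y s <= 1.
Proof.
pose psi s y v := cond_out mean_input TC S (in_block w y s) v *
  (agree (predC (on (outA net) S)) (out_block y0 s) v)%:R.
have agC y s : agree_out (finset.setC S) y0 y ->
    agree (predC (on (outA net) S)) (out_block y0 s) (out_block y s).
  move=> /(agree_out_block s)/agreeP h; apply/agreeP => e eS; apply: h.
  by rewrite /on finset.inE.
rewrite (eq_bigr (fun y => \prod_s psi s y (out_block y s))); last first.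
  by move=> y yy; apply: eq_bigr => s _; rewrite /psi agC ?mulr1.
apply: (sum_causal_kernels_le1 (psi := psi) (rank := @step_rank _ _ _ pi n))
  => [|s y v|s y|s y y' yy|y y' _ _].
- exact: step_rank_inj.
- by rewrite /psi mulr_ge0 // cond_out_ge0 //; exact: mean_input_pmf.
- rewrite /psi; under eq_bigr => v _ do rewrite mulr_natr mulrb.
  by rewrite -big_mkcond; apply: sum_cond_out; exact: mean_input_pmf.
- by move=> v; rewrite /psi /in_block (inputs_past c w (out_block_past yy)).
- exact: out_block_inj.
Qed.

(** Outputs outside [S] are summed first: [f] and the cut kernels do not depend on them, and the
    rest kernels have mass at most one. *)
Lemma sum_out_le w y0 (f : outputs -> R) : (forall y, 0 <= f y) ->
  (forall y y', agree_out S y y' -> f y = f y') ->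
  \sum_y f y * \prod_s (cut_kernel w y s * rest_kernel w y s) <=
  \sum_(y | agree_out (finset.setC S) y0 y) f y * \prod_s cut_kernel w y s.
Proof.
move=> f0 fS; rewrite -(sum_agree_out S y0); apply: ler_sum => y _.
rewrite (eq_bigr (fun z => f y * \prod_s cut_kernel w y s * \prod_s rest_kernel w z s)).
  rewrite -mulr_sumr ler_piMr ?mulr_ge0 ?prod_cut_kernel_ge0 //.
  exact: sum_rest_kernel_le1.
move=> z yz; rewrite big_split /= mulrA (fS _ _ yz); congr (_ * _ * _).
by apply: eq_bigr => s _; rewrite (cut_kernel_agree _ (agree_refl _ w) yz).
Qed.

(** Correctness is asked only of the destination [d] outside [T], whose observations lie in [S]. *)
Definition correct w y : bool :=
  [forall i : {i : 'I_N | i \in V},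
     dec c i d (w (val d)) (fun l => history (leqnn n) y (l, val d)) == w (val i)].

Lemma correct_agree w y y' : agree_out S y y' -> correct w y = correct w y'.
Proof.
move=> /agree_outP yy; apply: eq_forallb => i; congr (dec c i d _ _ == _).
apply: functional_extensionality_dep => l; apply: eq_from_tnth => t.
by rewrite !tnth_mktuple yy // !finset.inE.
Qed.

(** The decoder at [d] sees the messages only through that of [d], which lies outside [T]; so given
    [y] both tuples yield the same estimates. Non-sources have a single message. *)
Lemma correct_inj w w' y : agree (fun i => i \notin T) w w' ->
  correct w y -> correct w' y -> w = w'.
Proof.
move=> /agreeP ww /forallP cw /forallP cw'; apply/ffunP => i.
have [iV|iV] := boolP (i \in V).
  have /eqP <- := cw (exist _ i iV); have /eqP <- := cw' (exist _ i iV).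
  by rewrite (ww _ dT).
have := code_msg_source c iV => M1; apply: val_inj => /=.
have := ltn_ord (w i); have := ltn_ord (w' i).
move: (nat_of_ord (w i)) (nat_of_ord (w' i)) => a b.
by rewrite M1 !ltnS !leqn0 => /eqP -> /eqP ->.
Qed.

(** * The comparison law and its total mass *)

Definition unif : R := \prod_(i < N) (M i)%:R^-1.
Definition cut_msgs : R := \prod_(i in T) (M i)%:R.

Lemma msgs_gt0 i : 0 < (M i)%:R :> R.
Proof. by rewrite ltr0n (code_msg_gt0 c). Qed.

Lemma unif_gt0 : 0 < unif.
Proof. by apply: prodr_gt0 => i _; rewrite invr_gt0 msgs_gt0. Qed.

Lemma cut_msgs_ge1 : 1 <= cut_msgs.
Proof.
rewrite /cut_msgs -natr_prod ler1n; apply: prodn_cond_gt0 => i _.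
exact: code_msg_gt0 c i.
Qed.

Lemma sum_unif : \sum_(w : messages M) unif = 1.
Proof.
rewrite (sum_dffun_prod (fun i (_ : 'I_(M i)) => (M i)%:R^-1)).
rewrite big1 // => i _; rewrite sumr_const card_ord -[LHS]mulr_natr mulVf //.
exact: lt0r_neq0 (msgs_gt0 i).
Qed.

(** [unif * cut_msgs] is the uniform probability of the messages outside [T]; those of [T] are
    frozen to [w0]. *)
Lemma sum_unif_cut w0 :
  \sum_(w | agree (predC (fun i => i \notin T)) w0 w) unif * cut_msgs = 1.
Proof.
pose F i (t : 'I_(M i)) : R := if i \in T then (w0 i == t)%:R else (M i)%:R^-1.
transitivity (\sum_(w : messages M) \prod_i F i (w i)).
  rewrite big_mkcond; apply: eq_bigr => w _; case: ifP => [/agreeP|/negbT].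
    move=> ww; rewrite /unif /cut_msgs [X in _ * X]big_mkcond -big_split /=.
    apply: eq_bigr => i _; rewrite /F; case: ifP => iT; last by rewrite mulr1.
    by rewrite ww ?eqxx /= ?iT // mulVf // lt0r_neq0 ?msgs_gt0.
  rewrite negb_forall => /existsP[i].
  rewrite negb_imply /= negbK => /andP[iT ww].
  by rewrite (bigD1 i) //= /F iT (negbTE ww) mul0r.
rewrite (sum_dffun_prod F) big1 // => i _; rewrite /F.
have [iT|iT] := boolP (i \in T).
  rewrite (bigD1 (w0 i)) //= eqxx big1 ?addr0 // => t.
  by rewrite eq_sym => /negbTE ->.
rewrite sumr_const card_ord -[LHS]mulr_natr mulVf //.
exact: lt0r_neq0 (msgs_gt0 i).
Qed.

(* The likelihood, relative to the uniform prior, of a guess that mixes the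
   decoder's output with a uniform one. *)
Definition guess w y : R := 2^-1 * (cut_msgs * (correct w y)%:R + 1).

(* Up to [guess], a law under which the outputs seen across the cut are
   generated by [cond_out], hence are independent of the messages of [T]. *)
Definition aux_law w y : R :=
  unif * guess w y * \prod_s (cut_kernel w y s * rest_kernel w y s).

Lemma rest_kernel_ge0 w y s : 0 <= rest_kernel w y s.
Proof. by rewrite divr_ge0 ?channel_ge0 ?out_marginal_ge0. Qed.

Lemma guess_gt0 w y : 0 < guess w y.
Proof.
rewrite mulr_gt0 ?invr_gt0 // ltr_wpDl // mulr_ge0 //.
exact: le_trans ler01 cut_msgs_ge1.
Qed.

Lemma aux_law_ge0 w y : 0 <= aux_law w y.
Proof.
apply: mulr_ge0; first by rewrite mulr_ge0 ?(ltW unif_gt0) ?(ltW (guess_gt0 _ _)).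
by apply: prodr_ge0 => s _; rewrite mulr_ge0 ?cut_kernel_ge0 ?rest_kernel_ge0.
Qed.

(** Both parts of [guess] contribute mass at most one before halving. In the decoder part [cut_msgs]
    is offset because, given the outputs and the messages outside [T], at most one choice of the
    messages of [T] is decoded correctly. *)
Lemma sum_aux_law : \sum_w \sum_y aux_law w y <= 1.
Proof.
have [ref _] := outcome_exists op c.
have C0 : 0 <= cut_msgs by exact: le_trans ler01 cut_msgs_ge1.
have U0 := ltW unif_gt0.
pose Pr w y := \prod_s (cut_kernel w y s * rest_kernel w y s).
have half1 : \sum_w \sum_y unif * Pr w y <= 1.
  rewrite -[leRHS]sum_unif; apply: ler_sum => w _; rewrite -mulr_sumr ler_piMr //.
  have := @sum_out_le w (outY ref) (fun=> 1) (fun=> ler01) (fun _ _ _ => erefl).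
  under eq_bigr do rewrite mul1r; under [X in _ <= X]eq_bigr do rewrite mul1r.
  by move/le_trans; apply; exact: sum_cut_kernel_le1.
have half2 : \sum_w \sum_y unif * cut_msgs * ((correct w y)%:R * Pr w y) <= 1.
  apply: (@le_trans _ _ (\sum_w unif * cut_msgs *
      \sum_(y | agree_out (finset.setC S) (outY ref) y)
        (correct w y)%:R * \prod_s cut_kernel w y s)).
    apply: ler_sum => w _; rewrite -mulr_sumr ler_wpM2l ?mulr_ge0 //.
    by apply: sum_out_le => // y y' /(correct_agree w) ->.
  (* The outer sum is over messages outside [T], the inner one over those of [T], on which the cut
     kernels do not depend. *)
  rewrite -(sum_agree_merge (fun i => i \notin T) (outW ref)).
  rewrite -[leRHS](sum_unif_cut (outW ref)); apply: ler_sum => w0 _.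
  rewrite -mulr_sumr ler_piMr ?mulr_ge0 // exchange_big /=.
  apply: le_trans (sum_cut_kernel_le1 w0 (outY ref)); apply: ler_sum => y _.
  rewrite (eq_bigr (fun w => (correct w y)%:R * \prod_s cut_kernel w0 y s)); last first.
    move=> w ww; congr (_ * _); apply: eq_bigr => s _.
    by apply/esym/cut_kernel_agree => //; apply/agree_outP.
  rewrite -mulr_suml ler_piMl ?prod_cut_kernel_ge0 //.
  have [w1 /andP[ww1 cw1]|none] :=
    pickP (fun w => agree (fun i => i \notin T) w0 w && correct w y); last first.
    by rewrite big1 ?ler01 // => w ww; have := none w; rewrite /= ww /= => ->.
  rewrite (bigD1 w1) //= cw1 big1 ?addr0 // => w /andP[ww nw].
  case: (boolP (correct w y)) => // cw; case/eqP: nw.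
  apply: (correct_inj _ cw cw1); apply/agreeP => i iT.
  by move/agreeP: ww => <- //; move/agreeP: ww1 => ->.
rewrite (eq_bigr (fun w => 2^-1 *
    (\sum_y unif * cut_msgs * ((correct w y)%:R * Pr w y)) +
    2^-1 * \sum_y unif * Pr w y)).
  by rewrite big_split /= -!mulr_sumr; lra.
move=> w _; rewrite !mulr_sumr -big_split; apply: eq_bigr => y _.
by rewrite /aux_law /guess -/(Pr w y) /=; ring.
Qed.

Lemma code_law_pos w y : code_law op c w y != 0 ->
  forall s, [/\ 0 < mean_input (in_block w y s),
    0 < channel net s.2 (in_block w y s) (out_block y s),
    0 < cut_kernel w y s & 0 < out_marginal S (in_block w y s) (out_block y s)].
Proof.
move=> Pwy s; have m0 := mean_input_gt0 s Pwy.
have q0 : 0 < channel net s.2 (in_block w y s) (out_block y s).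
  rewrite lt0r channel_ge0 andbT; move: Pwy; rewrite code_lawE // mulf_eq0 negb_or.
  by case/andP => _ /prodf_neq0/(_ s isT).
split=> //; first by rewrite cond_out_gt0 //; exact: mean_input_pmf.
exact: lt_le_trans q0 (channel_le_out_marginal _ _ _).
Qed.

Lemma sum_code_law (f : outcome net n M -> R) :
  \sum_(z : messages M * outputs) code_law op c z.1 z.2 * f (z.1, inputs c z.1 z.2, z.2) =
  \sum_o P o * f o.
Proof.
rewrite sum_law -(pair_bigA _ (fun w y => code_law op c w y * f (w, inputs c w y, y))).
by [].
Qed.

(** * Expected log-likelihood ratio and the bound for one cut *)

Definition density h (u : subfamily (inA net) (Omega h)) v : R :=
  log2 (out_marginal S u v / cond_out mean_input TC S u v).

(** Each density involves one block at one time, so by [pr_block] its expectation is linear in the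
    law of that block's input. As the density itself is the same at all times, averaging over time
    gives exactly the cut information. *)
Lemma expected_density :
  \sum_o P o * \sum_s density (restr (Omega s.2) (outX o s.1))
                             (restr (Omega s.2) (outY o s.1)) =
  n%:R * cut_info (product_law mean_input) T.
Proof.
rewrite cut_info_product; last exact: mean_input_pmf.
under eq_bigr => o _ do rewrite mulr_sumr.
rewrite exchange_big /= -(pair_bigA _ (fun k h => \sum_o P o *
  density (restr (Omega h) (outX o k)) (restr (Omega h) (outY o k)))) /=.
rewrite exchange_big mulr_sumr; apply: eq_bigr => h _.
transitivity (\sum_(k < n) \sum_u \sum_v
   pr P [pred o | restr (Omega h) (outX o k) == u] * channel net h u v * density u v).
  apply: eq_bigr => k _.
  rewrite (partition_big (fun o => restr (Omega h) (outX o k)) predT) //=.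
  apply: eq_bigr => u _.
  rewrite (partition_big (fun o => restr (Omega h) (outY o k)) predT) //=.
  apply: eq_bigr => v _; rewrite -(pr_block c Hnet (s := (k, h))) /pr /= mulr_suml.
  by apply: eq_bigr => o /andP[/eqP -> /eqP ->].
rewrite exchange_big mulr_sumr; apply: eq_bigr => u _.
rewrite exchange_big mulr_sumr; apply: eq_bigr => v _.
by rewrite -!mulr_suml !mulrA divff ?mul1r // code_length_neq0.
Qed.

(** Gibbs' inequality for [code_law] against [aux_law]. The channel values cancel, leaving the
    logarithm of [guess] minus the densities; [guess] is at least [cut_msgs / 2] when [d] decodes
    correctly and at least [1 / 2] always, and this halving costs the one bit on the right. *)
Lemma converse_bound :
  (1 - error_prob op c) * \sum_(i in T) log2 (M i)%:R <=
  1 + n%:R * cut_info (product_law mean_input) T.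
Proof.
have [P_ge0 P1] := law_pmf op c.
have C1 := cut_msgs_ge1; have C0 : 0 < cut_msgs by exact: lt_le_trans ltr01 C1.
have msgsE : \sum_(i in T) log2 (M i)%:R = log2 cut_msgs.
  rewrite /cut_msgs big_mkcond [X in log2 X]big_mkcond log2_prod => [|i].
    by apply: eq_bigr => i _; case: ifP => // _; rewrite log2_1.
  by case: ifP => // _; exact: msgs_gt0.
have gibbs : \sum_(z : messages M * outputs) code_law op c z.1 z.2 *
    log2 (aux_law z.1 z.2 / code_law op c z.1 z.2) <= 0.
  apply: (gibbs_inequality (P := fun z : messages M * outputs => code_law op c z.1 z.2)).
  - split=> [z|]; first exact: law_ge0.
    rewrite -P1 -[RHS](eq_bigr _ (fun o _ => mulr1 (P o))).
    by rewrite -(sum_code_law (fun=> 1)); apply: eq_bigr => z _; rewrite mulr1.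
  - move=> z Pz; apply: mulr_gt0; first by rewrite mulr_gt0 ?unif_gt0 ?guess_gt0.
    apply: prodr_gt0 => s _; have [_ q0 r0 m0] := code_law_pos Pz s.
    by rewrite mulr_gt0 // divr_gt0.
  - apply: le_trans sum_aux_law; rewrite pair_bigA /= big_mkcond.
    by apply: ler_sum => z _; case: ifP => // _; exact: aux_law_ge0.
pose ok (o : outcome net n M) := correct (outW o) (outY o).
have split_log (z : messages M * outputs) : code_law op c z.1 z.2 != 0 ->
    log2 (aux_law z.1 z.2 / code_law op c z.1 z.2) =
    log2 (guess z.1 z.2) - \sum_s density (in_block z.1 z.2 s) (out_block z.2 s).
  move=> Pz; have pos := code_law_pos Pz.
  rewrite -log2_prod => [|s]; last by have [_ _ r0 m0] := pos s; rewrite divr_gt0.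
  rewrite -log2V ?prodr_gt0 // => [|s _]; last first.
    by have [_ _ r0 m0] := pos s; rewrite divr_gt0.
  rewrite -log2M ?guess_gt0 ?invr_gt0 ?prodr_gt0 // => [|s _]; last first.
    by have [_ _ r0 m0] := pos s; rewrite divr_gt0.
  rewrite /aux_law code_lawE // -/unif; congr log2.
  set q := \prod_s channel _ _ _ _.
  have q0 : 0 < q by apply: prodr_gt0 => s _; have [] := pos s.
  set p := (X in _ = _ * X).
  have -> : \prod_s (cut_kernel z.1 z.2 s * rest_kernel z.1 z.2 s) = q * p.
    rewrite /p -prodfV -big_split /=; apply: eq_bigr => s _.
    by rewrite invfM invrK /rest_kernel /cut_kernel mulrC -mulrA.
  have u0 := unif_gt0.
  by field; rewrite !lt0r_neq0.
have bound (o : outcome net n M) :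
    (ok o)%:R * log2 cut_msgs - 1 <= log2 (guess (outW o) (outY o)).
  rewrite /guess -/(ok o) log2M ?invr_gt0 //; last first.
    by rewrite ltr_wpDl // mulr_ge0 // ltW.
  rewrite log2V // log2_2 addrC lerD2l; case: (ok o); rewrite ?mul1r ?mul0r ?mulr1 ?mulr0.
    by rewrite ler_log2 // lerDl.
  by rewrite add0r log2_1.
have E1 : \sum_o P o * ((ok o)%:R * log2 cut_msgs - 1) <=
    \sum_o P o * log2 (guess (outW o) (outY o)).
  by apply: ler_sum => o _; rewrite ler_wpM2l.
have E2 : \sum_o P o * log2 (guess (outW o) (outY o)) <=
    n%:R * cut_info (product_law mean_input) T.
  rewrite -expected_density -subr_le0 -sumrB.
  rewrite -(eq_bigr _ (fun o _ => mulrBr (P o) _ _)).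
  rewrite -sum_code_law; apply: le_trans gibbs; apply: ler_sum => z _.
  have [->|Pz] := eqVneq (code_law op c z.1 z.2) 0; first by rewrite !mul0r.
  by rewrite split_log.
(* An error at [d] is an error of the code, so [ok] fails with probability at most [error_prob]. *)
have E3 : (1 - error_prob op c) * log2 cut_msgs - 1 <=
    \sum_o P o * ((ok o)%:R * log2 cut_msgs - 1).
  under eq_bigr => o _ do rewrite mulrBr mulr1 mulrA.
  rewrite sumrB P1 lerD2r -mulr_suml ler_wpM2r //.
    by rewrite -log2_1 ler_log2.
  rewrite lerBlDr -[leLHS]P1 /error_prob /pr.
  rewrite [X in _ + X]big_mkcond -big_split /=; apply: ler_sum => o _.
  case: ifP => [_|/negbT]; first by rewrite lerDr mulr_ge0 ?ler0n ?P_ge0.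
  rewrite negb_exists => /forallP err; suff -> : ok o by rewrite mulr1 addr0.
  apply/forallP => i; move: (err i); rewrite negb_exists => /forallP/(_ d).
  by rewrite negbK.
by rewrite msgsE; lra.
Qed.
End Converse.

(** * Limits along an ultrafilter *)

Section Limits.
Variable R : realType.

(** Compactness of [[a, b]] gives a cluster point, and an ultrafilter converges to its cluster
    points. *)
Lemma ultra_bounded_cvg (U : set_system nat) (x : nat -> R) (a b : R) :
  UltraFilter U -> (forall n, a <= x n <= b) ->
  exists l : R, x n @[n --> U] --> l.
Proof.
move=> UU x_ab.
have xU : U (x @^-1` `[a, b]) by apply: filterE => n /=; rewrite in_itv /= x_ab.
have [l [_ cl]] := @segment_compact R a b (fmap x U) _ xU.
exists l => V Vl; have [//|UnV] := in_ultra_setVsetC (x @^-1` V) UU.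
by have [y []] : (~` V) `&` V !=set0 by exact: (cl (~` V) V).
Qed.

Variables (U : set_system nat) (UF : ProperFilter U).

Lemma cvg_sum (I : Type) (r : seq I) (Q : pred I) (f : I -> nat -> R) (l : I -> R) :
  (forall i, Q i -> f i n @[n --> U] --> l i) ->
  (\sum_(i <- r | Q i) f i n) @[n --> U] --> \sum_(i <- r | Q i) l i.
Proof.
by move=> h; apply: cvg_big => //; exact: add_continuous.
Qed.

Lemma cvg_prod (I : Type) (r : seq I) (Q : pred I) (f : I -> nat -> R) (l : I -> R) :
  (forall i, Q i -> f i n @[n --> U] --> l i) ->
  (\prod_(i <- r | Q i) f i n) @[n --> U] --> \prod_(i <- r | Q i) l i.
Proof.
by move=> h; apply: cvg_big => //; exact: mul_continuous.
Qed.

Lemma cvg_pr (Z : finType) (P : nat -> Z -> R) (Q : Z -> R) (E : pred Z) :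
  (forall z, P n z @[n --> U] --> Q z) -> pr (P n) E @[n --> U] --> pr Q E.
Proof. by move=> PQ; apply: cvg_sum. Qed.

Lemma cvg_ge0 (x : nat -> R) (l : R) :
  x n @[n --> U] --> l -> (forall n, 0 <= x n) -> 0 <= l.
Proof.
move=> xl x0; have <- := cvg_lim (@Rhausdorff R) xl.
by apply: limr_ge; [apply/cvg_ex; exists l|exact: nearW].
Qed.

Lemma cvg_pmf (Z : finType) (P : nat -> Z -> R) (Q : Z -> R) :
  (forall n, is_pmf (P n)) -> (forall z, P n z @[n --> U] --> Q z) -> is_pmf Q.
Proof.
move=> P_pmf PQ; split=> [z|].
  by apply: cvg_ge0 (PQ z) _ => n; case: (P_pmf n).
have : (\sum_z P n z) @[n --> U] --> \sum_z Q z by apply: cvg_sum.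
have -> : (fun n => \sum_z P n z) = cst 1 by apply/funext => n; case: (P_pmf n).
by move=> /(cvg_lim (@Rhausdorff R)) <-; rewrite lim_cst //; exact: Rhausdorff.
Qed.

(** With [s] the square root of [b], this is [ln s^-1 <= s^-1] multiplied by [2 * b]. *)
Lemma normr_mul_ln (b : R) : 0 <= b <= 1 -> `|b * ln b| <= 2 * Num.sqrt b.
Proof.
move=> /andP[]; rewrite le_eqVlt => /orP[/eqP <-|b0] b1.
  by rewrite mul0r normr0 mulr_ge0 // sqrtr_ge0.
have s0 : 0 < Num.sqrt b by rewrite sqrtr_gt0.
set s := Num.sqrt b in s0 *.
have bE : b = s * s by rewrite -expr2 sqr_sqrtr // ltW.
have lnb : ln b = - (2 * ln s^-1) by rewrite bE lnM ?posrE // lnV ?posrE //; ring.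
have ls : ln s^-1 <= s^-1.
  have /le_ln1Dx : -1 < s^-1 - 1 by rewrite ltrBrDl subrr invr_gt0.
  by rewrite addrC subrK => /le_trans; apply; rewrite gerBl.
have ls0 : 0 <= ln s^-1.
  rewrite ln_ge0 // invf_ge1 // -sqrtr1 ler_sqrt //.
rewrite lnb mulrN normrN ger0_norm; last by rewrite !mulr_ge0 // ltW.
have -> : 2 * s = b * (2 * s^-1) by rewrite bE; field; exact: lt0r_neq0.
by rewrite ler_wpM2l ?(ltW b0) // ler_wpM2l.
Qed.

(** Only [lb = 0] is delicate, the logarithm being discontinuous there. Then [la = 0] too, and
    domination of [a] by [b] squeezes the product through [normr_mul_ln]. *)
Lemma cvg_mul_log2 (a b : nat -> R) (la lb : R) :
  (forall n, 0 <= a n <= b n) -> (forall n, b n <= 1) ->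
  a n @[n --> U] --> la -> b n @[n --> U] --> lb ->
  a n * log2 (b n) @[n --> U] --> la * log2 lb.
Proof.
move=> ab b1 ala blb.
have lb0 : 0 <= lb.
  by apply: cvg_ge0 blb _ => n; case/andP: (ab n) => /le_trans; apply.
have la0 : 0 <= la by apply: cvg_ge0 ala _ => n; case/andP: (ab n).
have lab : 0 <= lb - la.
  by apply: cvg_ge0 (cvgB blb ala) _ => n; rewrite subr_ge0; case/andP: (ab n).
have [lb_gt0|] := ltP 0 lb.
  rewrite /log2; apply: cvgM => //; apply: cvgMl.
  exact: (continuous_cvg _ (continuous_ln lb_gt0) blb).
move=> lb_le0; have lb_eq0 : lb = 0 by apply/eqP; rewrite eq_le lb_le0 lb0.
have -> : la = 0 by apply/eqP; rewrite eq_le la0 andbT; move: lab; rewrite lb_eq0; lra.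
rewrite mul0r.
have sq0 : 2 * Num.sqrt (b n) / ln 2 @[n --> U] --> 0.
  rewrite -[X in _ --> X](mul0r (ln 2)^-1) -[X in X * _](mulr0 2) -sqrtr0 -lb_eq0.
  apply: cvgMl; apply: cvgMr.
  exact: (continuous_cvg _ (@sqrt_continuous R lb) blb).
apply: (@squeeze_cvgr _ _ _ _ (fun n => - (2 * Num.sqrt (b n) / ln 2))
  (fun n => 2 * Num.sqrt (b n) / ln 2)) => //.
  apply: nearW => n; rewrite -ler_norml /log2 mulrA normrM.
  rewrite [`|(ln 2)^-1|]ger0_norm ?invr_ge0 ?(ltW (ln2_gt0 R)) //.
  rewrite ler_wpM2r ?invr_ge0 ?(ltW (ln2_gt0 R)) //.
  have /andP[a0 anb] := ab n; have b0 := le_trans a0 anb.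
  apply: le_trans (normr_mul_ln _); last by rewrite b0 b1.
  by rewrite !normrM ler_wpM2r // !ger0_norm.
by rewrite -oppr0; exact: cvgN.
Qed.

(** The logarithm splits into four terms, each [p z] times the logarithm of the probability of an
    event containing [z]; that probability dominates [p z], as [cvg_mul_log2] requires. *)
Lemma cvg_cond_mutual_info (Z A B C : finType) (P : nat -> Z -> R) (Q : Z -> R)
    (F : Z -> A) (G : Z -> B) (H : Z -> C) :
  (forall n, is_pmf (P n)) -> (forall z, P n z @[n --> U] --> Q z) ->
  cond_mutual_info (P n) F G H @[n --> U] --> cond_mutual_info Q F G H.
Proof.
move=> P_pmf PQ; have Q_pmf := cvg_pmf P_pmf PQ.
pose t (p : Z -> R) (E : Z -> pred Z) z := p z * log2 (pr p (E z)).
pose E1 z : pred Z := [pred t | [&& F t == F z, G t == G z & H t == H z]].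
pose E2 z : pred Z := [pred t | H t == H z].
pose E3 z : pred Z := [pred t | (F t == F z) && (H t == H z)].
pose E4 z : pred Z := [pred t | (G t == G z) && (H t == H z)].
have self z : [/\ E1 z z, E2 z z, E3 z z & E4 z z].
  by split; rewrite /E1 /E2 /E3 /E4 /= !eqxx.
have splitE p : is_pmf p -> cond_mutual_info p F G H =
    \sum_z (t p E1 z + t p E2 z - (t p E3 z + t p E4 z)).
  move=> [p0 _]; rewrite cond_mutual_infoE; apply: eq_bigr => z _.
  rewrite -/(E1 z) -/(E2 z) -/(E3 z) -/(E4 z) /t.
  have [->|pz] := eqVneq (p z) 0; first by rewrite !mul0r; ring.
  have pos (E : pred Z) : E z -> 0 < pr p E.
    by move=> Ez; apply: lt_le_trans (pr_le p0 Ez); rewrite lt0r pz p0.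
  have [/pos e1 /pos e2 /pos e3 /pos e4] := self z.
  by rewrite log2M ?mulr_gt0 ?invr_gt0 ?mulr_gt0 // log2V ?mulr_gt0 // !log2M //; ring.
have tQ (E : Z -> pred Z) z : E z z -> t (P n) E z @[n --> U] --> t Q E z.
  move=> Ez; apply: cvg_mul_log2; last exact: cvg_pr.
  - by move=> n; have [P0 _] := P_pmf n; rewrite P0 pr_le.
  - move=> n; have [P0 <-] := P_pmf n.
    by rewrite /pr big_mkcond; apply: ler_sum => z' _; case: ifP.
  - exact: PQ.
rewrite splitE //; under eq_cvg => n do rewrite splitE //.
apply: cvg_sum => z _; have [e1 e2 e3 e4] := self z.
by apply: cvgB; apply: cvgD; exact: tQ.
Qed.
End Limits.

(** * Asymptotic rates and the outer bound *)

Lemma limn_einf_near (R : realType) (u : nat -> R) (x e : R) : 0 < e ->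
  (x%:E <= limn_einf (fun n => (u n)%:E))%E -> \forall n \near \oo, x - e <= u n.
Proof.
move=> e0; rewrite limn_einf_lim => xu.
have xe : ((x - e)%:E < limn (einfs (fun n => (u n)%:E)))%E.
  by apply: lt_le_trans xu; rewrite lte_fin gtrBl.
(* The lower limit is the supremum of the tail infima, so some tail has infimum above [x - e]. *)
have : limn (einfs (fun n => (u n)%:E)) = ereal_sup (range (einfs (fun n => (u n)%:E))).
  by apply/cvg_lim => //; exact: cvg_einfs_sup.
move=> E; move: xe; rewrite E => /ereal_sup_gt[_ [m _ <-] xm].
exists m => // n /= mn; rewrite -lee_fin; apply: ltW (lt_le_trans xm _).
by apply: ereal_inf_lbound; exists n.
Qed.

Section OuterBound.
Variables (R : realType) (N : nat) (net : network R N) (V D : {set 'I_N}).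
Variables (op : operation net V D) (pi : op_sequence net) (B : delay_profile N).
Hypothesis Hnet : is_DM_MMN op.

Lemma cvg_product_law (U : set_system nat) (UF : ProperFilter U)
    (p : nat -> forall h : 'I_(alpha net), subfamily (inA net) (Omega h) -> R)
    (q : forall h : 'I_(alpha net), subfamily (inA net) (Omega h) -> R) z :
  (forall h u, p n h u @[n --> U] --> q h u) ->
  product_law (p n) z @[n --> U] --> product_law q z.
Proof.
by move=> pq; apply: cvg_prod => h _; apply: cvgMl; exact: pq.
Qed.

Lemma pmf_le1 (Z : finType) (P : Z -> R) z : is_pmf P -> P z <= 1.
Proof.
by case=> P0 <-; rewrite (bigD1 z) //= lerDl sumr_ge0.
Qed.

(** [converse_bound] divided by the block length [n + 1]. The error term is measured against the
    fixed sum rate [rho], so the rates of the codes may be unbounded. *)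
Lemma converse_near (r : 'I_N -> R) (M : nat -> 'I_N -> nat)
    (c : forall n, network_code V D pi B n.+1 (M n)) (T : {set 'I_N}) (e : R) :
  (forall i, 0 <= r i) ->
  (forall i, ((r i)%:E <=
     limn_einf (fun n => (log2 (M n i)%:R / n.+1%:R)%:E))%E) ->
  (fun n => error_prob op (c n)) @ \oo --> (0 : R) ->
  finset.setI (finset.setC T) D != finset.set0 -> 0 < e ->
  \forall n \near \oo,
    \sum_(i in T) r i - e <= cut_info (product_law (mean_input op (c n))) T.
Proof.
move=> r0 rate err /set0Pn[j]; rewrite !finset.inE => /andP[jT jD] e0.
pose d : {j : 'I_N | j \in D} := exist _ j jD.
pose rho := \sum_(i in T) r i.
have rho0 : 0 <= rho by apply: sumr_ge0.
(* The budget [e / 2] is shared among the nodes of [T]; [N.+1] bounds their number and is positive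
   even for [N = 0]. *)
pose e1 := e / 2 / N.+1%:R.
have e1_gt0 : 0 < e1 by rewrite !divr_gt0.
have rates : \forall n \near \oo, forall i, r i - e1 <= log2 (M n i)%:R / n.+1%:R.
  by apply: filter_forall => i; exact: limn_einf_near.
have small : \forall n \near \oo, error_prob op (c n) * rho + n.+1%:R^-1 <= e / 2.
  have : error_prob op (c n) * rho + n.+1%:R^-1 @[n --> \oo] --> (0 * rho + 0 : R).
    by apply: cvgD; [exact: cvgMl|exact: cvg_harmonic].
  rewrite mul0r addr0 => /cvgr_le; apply; exact: divr_gt0.
near=> n.
have conv := converse_bound (c n) Hnet (d := d) jT.
have sm : error_prob op (c n) * rho + n.+1%:R^-1 <= e / 2 by near: n.
have nearr : forall i, r i - e1 <= log2 (M n i)%:R / n.+1%:R by near: n.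
set err_n := error_prob op (c n) in conv sm *.
have n0 : 0 < n.+1%:R :> R by [].
have err0 : 0 <= err_n by apply/pr_ge0/law_ge0.
have err1 : err_n <= 1.
  have [P0 <-] := law_pmf op (c n).
  by rewrite /err_n /error_prob /pr big_mkcond; apply: ler_sum => o _; case: ifP.
have sum_rate : rho - e / 2 <= (\sum_(i in T) log2 (M n i)%:R) / n.+1%:R.
  apply: (@le_trans _ _ (\sum_(i in T) (r i - e1))).
    rewrite sumrB lerD2l lerN2 sumr_const -[leLHS]mulr_natr.
    have -> : e / 2 = e1 * N.+1%:R by rewrite /e1 divfK.
    rewrite ler_wpM2l ?(ltW e1_gt0) // ler_nat.
    by apply: leq_trans (max_card _) _; rewrite card_ord.
  by rewrite mulr_suml; apply: ler_sum.
set L := \sum_(i in T) _ in conv sum_rate.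
set C := cut_info _ _ in conv *.
have conv' : (1 - err_n) * (L / n.+1%:R) <= n.+1%:R^-1 + C.
  rewrite mulrA ler_pdivrMr // [leRHS]mulrDl mulVf ?lt0r_neq0 //.
  by rewrite [C * _]mulrC.
have main : (1 - err_n) * (rho - e / 2) <= n.+1%:R^-1 + C.
  by apply: le_trans conv'; rewrite ler_wpM2l // subr_ge0.
have err_e : 0 <= err_n * (e / 2) by rewrite mulr_ge0 // ltW ?divr_gt0.
rewrite -/rho; move: main sm err_e.
rewrite mulrBl mul1r mulrBr; move: (err_n * rho) (err_n * (e / 2)) => x y.
by move: (n.+1%:R^-1) => z; lra.
Unshelve. all: by end_near. Qed.

Lemma achievable_R_out (r : 'I_N -> R) : achievable op pi B r -> R_out net D r.
Proof.
move=> [r0 _ [M [c [rate err]]]].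
(* One input law must serve all cuts. Along a single ultrafilter refining the eventual filter, the
   limits exist for all blocks and input values at once, independently of [T]. *)
have [U [UU leU]] := @ultraFilterLemma nat \oo _.
have p_pmf n h : is_pmf (mean_input op (c n) (h := h)) by exact: mean_input_pmf.
have lim_ex h (u : subfamily (inA net) (Omega h)) :
    exists l : R, mean_input op (c n) u @[n --> U] --> l.
  apply: (@ultra_bounded_cvg _ _ _ 0 1) => n.
  by rewrite (pmf_le1 _ (p_pmf n h)) andbT; case: (p_pmf n h).
pose q h u := projT1 (cid (lim_ex h u)).
have pq h u : mean_input op (c n) u @[n --> U] --> q h u := projT2 (cid (lim_ex h u)).
have q_pmf h : is_pmf (q h) by exact: (cvg_pmf _ (p_pmf^~ h) (pq h)).
exists (product_law q); first exact: product_law_product_form.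
(* With a slack [e], the bound for the cut only has to hold eventually, with a threshold that may
   depend on [T] and [e]. *)
split=> // T /= TD; apply/ler_addgt0Pr => e e0; rewrite -lerBlDr.
have cut_cvg : cut_info (product_law (mean_input op (c n))) T @[n --> U] -->
    cut_info (product_law q) T.
  apply: cvg_cond_mutual_info => [n|z]; first exact: product_law_pmf.
  exact: cvg_product_law.
rewrite -(cvg_lim (@Rhausdorff R) cut_cvg).
apply: limr_ge; first by apply/cvg_ex; eexists; exact: cut_cvg.
by apply: leU; exact: converse_near.
Qed.
End OuterBound.

Theorem theorem1 (R : realType) (N : nat) (net : network R N)
    (V D : {set 'I_N}) (op : operation net V D) (Hnet : is_DM_MMN op) :
  (forall pi : op_sequence net, capacity_pi op pi `<=` R_out net D) /\
  capacity op `<=` R_out net D.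
Proof.
have sub pi : capacity_pi op pi `<=` R_out net D.
  by move=> r [B _]; exact: achievable_R_out.
by split=> // r [pi _]; exact: sub.
Qed.
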